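(* If a 2-step nilpotent Lie group $N$ equipped with a left invariant Riemannian metric $g$ admits an invertible left invariant Killing-Yano tensor, then $N$ is a complex Lie group. Moreover, $g$ is Hermitian with respect to this complex structure.
   Context: A Lie algebra $\mathfrak{n}$ is called 2-step nilpotent if it is not abelian and $[[\mathfrak{n},\mathfrak{n}],\mathfrak{n}]=0$, equivalently, it is not abelian and its commutator ideal $[\mathfrak{n},\mathfrak{n}]$ is contained in its center; a 2-step nilpotent Lie group is correspondingly a non-abelian Lie group whose commutator is contained in its center. A Killing-Yano (KY) tensor on a Riemannian manifold $(M,g)$ is a $(1,1)$-tensor $T$ (an endomorphism of $TM$) that is skew-symmetric with respect to $g$ and satisfies $(\nabla_X T)Y=-(\nabla_Y T)X$ for all vector fields $X,Y$, where $\nabla$ is the Levi-Civita connection of $g$; equivalently, the 2-form $\omega(X,Y)=g(TX,Y)$ satisfies $(\nabla_X\omega)(Y,Z)=-(\nabla_Y\omega)(X,Z)$ for all $X,Y,Z$. The tensor $T$ is invertible if it is an invertible endomorphism of each tangent space (equivalently, $\omega$ is non-degenerate), and it is left invariant if it is invariant under all left translations of the group. A complex Lie group carries a bi-invariant complex structure $J$, whose restriction to the Lie algebra $\mathfrak{n}$ of $N$ is a linear map $J:\mathfrak{n}\to\mathfrak{n}$ with $J^2=-\mathrm{Id}$ and $J[x,y]=[Jx,y]=[x,Jy]$ for all $x,y\in\mathfrak{n}$. The metric $g$ is Hermitian with respect to $J$ if $g(JX,JY)=g(X,Y)$ for all $X,Y$.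
   Formalization: N is assumed connected: the claim fails for disconnected groups such as Z acting on R^2 by powers of [[1,1],[0,1]]. ''Complex Lie group'' means that N has a bi-invariant smooth J with J^2 = -Id and vanishing Nijenhuis tensor. *)

(* Defs.v *)
From HB Require Import structures.
From mathcomp Require Import all_boot all_order all_algebra.
From mathcomp Require Import all_classical all_reals all_analysis.

Set Implicit Arguments.
Unset Strict Implicit.
Unset Printing Implicit Defensive.

Import Order.TTheory GRing.Theory Num.Theory.
Import numFieldNormedType.Exports.

Local Open Scope classical_set_scope.
Local Open Scope ring_scope.

(** [Ck k U f]: [f] is of class C^k on [U]; only used for open [U].  The
    derivative of [f] is C^k as soon as all directional derivatives of [f] are,
    the domains below being finite dimensional. *)
Fixpoint Ck (R : realType) (V W : normedModType R) (k : nat) (U : set V)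
    (f : V -> W) : Prop :=
  match k with
  | 0 => forall x, U x -> {for x, continuous f}
  | k'.+1 => (forall x, U x -> differentiable f x)
             /\ forall v : V, Ck k' U (fun x => 'D_v f x)
  end.

Definition smooth_on (R : realType) (V W : normedModType R) (U : set V)
    (f : V -> W) : Prop := forall k, Ck k U f.

(** [point] is the inverse of [coords] on [coords @` dom]; both functions are
    irrelevant outside of these sets. *)
Record chart (R : realType) (n : nat) (N : topologicalType) := Chart {
  dom : set N;
  coords : N -> 'rV[R]_n;
  point : 'rV[R]_n -> N;
  open_dom : open dom;
  open_image_coords : open (coords @` dom);
  coordsK : forall p, dom p -> point (coords p) = p;
  continuous_coords : forall p, dom p -> {for p, continuous coords};
  continuous_point :
    forall x, (coords @` dom) x -> {for x, continuous point} }.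

Definition chart_image (R : realType) (n : nat) (N : topologicalType)
  (c : chart R n N) : set 'rV[R]_n := coords c @` dom c.

(** A smooth structure, presented by an atlas in which a preferred chart
    [chart_at p] around each point [p] has been chosen.  Tangent vectors at [p]
    are represented by their components in the chart [chart_at p]. *)
Record smoothStructure (R : realType) (n : nat) (N : topologicalType) :=
  SmoothStructure {
    chart_at : N -> chart R n N;
    mem_chart_at : forall p, dom (chart_at p) p;
    smooth_transition : forall p q : N,
      smooth_on [set x | chart_image (chart_at p) x
                         /\ dom (chart_at q) (point (chart_at p) x)]
        (coords (chart_at q) \o point (chart_at p)) }.

#[short(type="topGroupType")]
HB.structure Definition TopGroup := {N of Group N & Topological N}.

Record lieGroup (R : realType) (n : nat) := LieGroup {
  carrier :> topGroupType;
  smooth_str : smoothStructure R n carrier;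
  hausdorff_carrier : hausdorff_space carrier;
  second_countable_carrier : @second_countable carrier;
  continuous_mul : continuous (fun z : carrier * carrier => (z.1 * z.2)%g);
  continuous_inv : continuous (fun a : carrier => a^-1%g);
  smooth_mul : forall p q r : carrier,
    let cp := chart_at smooth_str p in
    let cq := chart_at smooth_str q in
    let cr := chart_at smooth_str r in
    smooth_on [set z : 'rV[R]_n * 'rV[R]_n |
                [/\ chart_image cp z.1, chart_image cq z.2
                  & dom cr (point cp z.1 * point cq z.2)%g]]
      (fun z => coords cr (point cp z.1 * point cq z.2)%g);
  smooth_inv : forall p q : carrier,
    let cp := chart_at smooth_str p in
    let cq := chart_at smooth_str q in
    smooth_on [set x | chart_image cp x /\ dom cq (point cp x)^-1%g]
      (fun x => coords cq (point cp x)^-1%g) }.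

Definition two_step_nilpotent (N : groupType) : Prop :=
  (exists a b : N, (a * b <> b * a)%g)
  /\ forall a b c : N, commute [~ a, b]%g c.

Section Tensors.
Context {R : realType} {n : nat} {N : lieGroup R n}.

Local Notation "'ch' p" := (chart_at (smooth_str N) p) (at level 9, p at level 9).

Local Notation tangent := 'rV[R]_n.

(** Differential of [F : N -> N] at [p], from the tangent space at [p] to the
    tangent space at [F p]. *)
Definition tangent_map (F : N -> N) (p : N) : tangent -> tangent :=
  'd (coords (ch (F p)) \o F \o point (ch p)) (coords (ch p) p).

Definition left_translation (a : N) : N -> N := fun b => (a * b)%g.
Definition right_translation (a : N) : N -> N := fun b => (b * a)%g.

Definition smooth_function (f : N -> R) : Prop :=
  forall q : N, smooth_on (chart_image (ch q)) (f \o point (ch q) : _ -> R^o).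

(** The components of the vector field [X] in the chart [chart_at q]. *)
Definition local_field (q : N) (X : N -> tangent) : 'rV[R]_n -> 'rV[R]_n :=
  fun x => let p := point (ch q) x in
    'd (coords (ch q) \o point (ch p)) (coords (ch p) p) (X p).

Definition smooth_field (X : N -> tangent) : Prop :=
  forall q : N, smooth_on (chart_image (ch q)) (local_field q X).

Definition lie_derivative (X : N -> tangent) (f : N -> R) : N -> R :=
  fun p => 'D_(X p) (f \o point (ch p) : _ -> R^o) (coords (ch p) p).

Definition bracket (X Y : N -> tangent) : N -> tangent :=
  fun p => 'D_(X p) (local_field p Y) (coords (ch p) p)
         - 'D_(Y p) (local_field p X) (coords (ch p) p).

(** Smoothness is not built in; see [smooth_tensor11]. *)
Definition tensor11 : Type := N -> {linear tangent -> tangent}.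

Definition app_field (T : tensor11) (X : N -> tangent) : N -> tangent :=
  fun p => T p (X p).

Definition smooth_tensor11 (T : tensor11) : Prop :=
  forall X, smooth_field X -> smooth_field (app_field T X).

Definition invertible_tensor11 (T : tensor11) : Prop :=
  forall p, bijective (T p).

Definition left_invariant_tensor11 (T : tensor11) : Prop :=
  forall (a p : N) (v : tangent),
    T (a * p)%g (tangent_map (left_translation a) p v)
    = tangent_map (left_translation a) p (T p v).

Definition right_invariant_tensor11 (T : tensor11) : Prop :=
  forall (a p : N) (v : tangent),
    T (p * a)%g (tangent_map (right_translation a) p v)
    = tangent_map (right_translation a) p (T p v).

Definition riemannian_metric (g : N -> tangent -> tangent -> R) : Prop :=
  [/\ forall p u v, g p u v = g p v u,
      forall p (a : R) u v w, g p (a *: u + v) w = a * g p u w + g p v w,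
      forall p v, v != 0 -> 0 < g p v v
    & forall X Y, smooth_field X -> smooth_field Y ->
        smooth_function (fun p => g p (X p) (Y p))].

Definition left_invariant_metric (g : N -> tangent -> tangent -> R) : Prop :=
  forall (a p : N) (u v : tangent),
    g (a * p)%g (tangent_map (left_translation a) p u)
                (tangent_map (left_translation a) p v) = g p u v.

Definition affine_connection
    (nabla : (N -> tangent) -> (N -> tangent) -> (N -> tangent)) : Prop :=
  [/\ forall X Y, smooth_field X -> smooth_field Y -> smooth_field (nabla X Y),
      forall X X' Y p, smooth_field X -> smooth_field X' -> smooth_field Y ->
        nabla (X \+ X') Y p = nabla X Y p + nabla X' Y p,
      forall f X Y p, smooth_function f -> smooth_field X -> smooth_field Y ->
        nabla (fun q => f q *: X q) Y p = f p *: nabla X Y p,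
      forall X Y Y' p, smooth_field X -> smooth_field Y -> smooth_field Y' ->
        nabla X (Y \+ Y') p = nabla X Y p + nabla X Y' p
    & forall f X Y p, smooth_function f -> smooth_field X -> smooth_field Y ->
        nabla X (fun q => f q *: Y q) p
        = lie_derivative X f p *: Y p + f p *: nabla X Y p].

Definition levi_civita (g : N -> tangent -> tangent -> R)
    (nabla : (N -> tangent) -> (N -> tangent) -> (N -> tangent)) : Prop :=
  [/\ affine_connection nabla,
      forall X Y p, smooth_field X -> smooth_field Y ->
        nabla X Y p - nabla Y X p = bracket X Y p
    & forall X Y Z p, smooth_field X -> smooth_field Y -> smooth_field Z ->
        lie_derivative X (fun q => g q (Y q) (Z q)) p
        = g p (nabla X Y p) (Z p) + g p (Y p) (nabla X Z p)].

(** [(nabla_X T) Y]. *)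
Definition covariant_derivative11
    (nabla : (N -> tangent) -> (N -> tangent) -> (N -> tangent))
    (T : tensor11) (X Y : N -> tangent) : N -> tangent :=
  fun p => nabla X (app_field T Y) p - T p (nabla X Y p).

Definition killing_yano (g : N -> tangent -> tangent -> R)
    (nabla : (N -> tangent) -> (N -> tangent) -> (N -> tangent))
    (T : tensor11) : Prop :=
  [/\ smooth_tensor11 T,
      forall p u v, g p (T p u) v = - g p u (T p v)
    & forall X Y p, smooth_field X -> smooth_field Y ->
        covariant_derivative11 nabla T X Y p
        = - covariant_derivative11 nabla T Y X p].

(** Integrability of the almost complex structure [J] is expressed by the
    vanishing of its Nijenhuis tensor. *)
Definition complex_structure (J : tensor11) : Prop :=
  [/\ smooth_tensor11 J,
      forall p v, J p (J p v) = - v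
    & forall X Y p, smooth_field X -> smooth_field Y ->
        bracket (app_field J X) (app_field J Y) p
        - J p (bracket (app_field J X) Y p)
        - J p (bracket X (app_field J Y) p)
        - bracket X Y p = 0].

(** A complex Lie group structure on [N] compatible with its Lie group
    structure.  Given left and right invariance, the multiplication
    N x N -> N, whose differential at (a, b) is (u, v) |-> dR_b u + dL_a v,
    is holomorphic. *)
Definition complex_lie_group_structure (J : tensor11) : Prop :=
  [/\ complex_structure J, left_invariant_tensor11 J
    & right_invariant_tensor11 J].

Definition hermitian_metric (g : N -> tangent -> tangent -> R)
    (J : tensor11) : Prop :=
  forall p u v, g p (J p u) (J p v) = g p u v.

End Tensors.

Arguments tensor11 {R n} N.

(* Main.v *)
Require Import Defs.
From HB Require Import structures.
From mathcomp Require Import all_boot all_order all_algebra.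
From mathcomp Require Import all_classical all_reals all_analysis.
From mathcomp Require Import complex ring lra.
(* [all_analysis] shadows [Defs.point]. *)
Import Defs.

Set Implicit Arguments.
Unset Strict Implicit.
Unset Printing Implicit Defensive.

Import Order.TTheory GRing.Theory Num.Theory.
Import numFieldNormedType.Exports.

Local Open Scope classical_set_scope.
Local Open Scope ring_scope.

(** For left invariant fields the Koszul formula turns the Killing-Yano equation
    into an identity between brackets and inner products.  Evaluated on central
    vectors it shows that T preserves the center of the Lie algebra, and then
    that [Tx, y] = [x, Ty] and T [x, y] = 3 [Tx, y].  Hence -T^2 multiplies by 9
    when it is moved from an argument of the bracket to its value, so that the
    orthogonal factor J = T (-T^2)^(-1/2) of the polar decomposition of T
    satisfies J [x, y] = [Jx, y].  Being a polynomial in T, J is smooth, left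
    invariant and skew-symmetric.

    The Lie algebra is 2-step nilpotent because commutators are central in N:
    Ad(b a b^-1) = Ad(a), differentiated first in a and then in b, gives
    [[v, u], w] = 0.  Since J commutes with all ad(u), the map
    a |-> Ad(a) J Ad(a)^-1 has zero derivative, so it is constant on the
    connected group N and J is right invariant as well. *)

(** * Linear algebra of the Killing-Yano equation *)

(** On central arguments most brackets in the Killing-Yano identity vanish, and by 2-step nilpotency
    brackets, and then their images under T, may themselves be substituted there. The factor 3 is 1
    + 2: two expressions for T [x, y], exchanged by antisymmetry, are compared. It disappears from J
    because (-T^2)^(-1/2) contributes 1/3. That inverse square root is obtained by interpolating a
    |-> 1 / sqrt a on the finitely many eigenvalues of -T^2.

    Tangent vectors are components in a preferred chart that changes with the point, so a field or a
    family of differentials can be differentiated only after being moved to a fixed chart; [dmap]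
    and [frame] serve this purpose. No exponential map is used: brackets arise by differentiating
    identities between translations in charts.

    Integrability concerns all smooth fields, whereas the algebra controls left invariant ones only.
    The gap is closed by showing that the Nijenhuis expression depends only on the values of its
    arguments at the point. *)

Section InnerProduct.
Context {R : realType} {n : nat} (g : 'rV[R]_n.+1 -> 'rV[R]_n.+1 -> R).
Hypothesis gC : forall u v, g u v = g v u.
Hypothesis gP : forall a u v w, g (a *: u + v) w = a * g u w + g v w.
Hypothesis g_gt0 : forall v, v != 0 -> 0 < g v v.

Lemma inner_Dl u v w : g (u + v) w = g u w + g v w.
Proof. by have := gP 1 u v w; rewrite scale1r mul1r. Qed.

Lemma inner_0l w : g 0 w = 0.
Proof. by have := inner_Dl 0 0 w; rewrite addr0; lra. Qed.

Lemma inner_Zl a u w : g (a *: u) w = a * g u w.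
Proof. by have := gP a u 0 w; rewrite inner_0l !addr0. Qed.

Lemma inner_Dr u v w : g w (u + v) = g w u + g w v.
Proof. by rewrite gC inner_Dl !(gC w). Qed.

Lemma inner_Zr a u w : g w (a *: u) = a * g w u.
Proof. by rewrite gC inner_Zl (gC w). Qed.

Lemma inner_Nl u w : g (- u) w = - g u w.
Proof. by rewrite -scaleN1r inner_Zl mulN1r. Qed.

Lemma inner_Nr u w : g w (- u) = - g w u.
Proof. by rewrite gC inner_Nl gC. Qed.

Lemma inner_eq0 v : (g v v == 0) = (v == 0).
Proof.
apply/eqP/eqP => [gv0|->]; last exact: inner_0l.
by apply/eqP; apply/negP => /negP/g_gt0; rewrite gv0 ltxx.
Qed.

Lemma inner_ge0 v : 0 <= g v v.
Proof. by have [->|/g_gt0/ltW//] := eqVneq v 0; rewrite inner_0l. Qed.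

Section Symmetric.
Variable M : 'M[R]_n.+1.
Hypothesis Msym : forall u v, g (u *m M) v = g u (v *m M).
Hypothesis Mpos : forall v, v != 0 -> 0 < g (v *m M) v.

(** Let [x] and [y] be the real and imaginary parts of a complex eigenvector. Symmetry gives b
    (|x|^2 + |y|^2) = 0 for the imaginary part b of the eigenvalue; positivity on whichever of [x],
    [y] is nonzero then gives the sign of the real part. *)
Lemma char_poly_root_pos (z : R[i]) :
  root (map_poly (real_complex R) (char_poly M)) z -> exists2 a : R, z = a%:C%C & 0 < a.
Proof.
rewrite -[map_poly _ _]/(map_poly (real_complex R) _) map_char_poly.
rewrite -eigenvalue_root_char => /eigenvalueP[v vM v0].
pose x := map_mx (@complex.Re R) v; pose y := map_mx (@complex.Im R) v.
move: z vM => [a b] vM.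
have xM : x *m M = a *: x - b *: y.
  apply/rowP => j; have /(congr1 (fun w : 'rV_n.+1 => complex.Re (w 0 j))) := vM.
  rewrite !mxE raddf_sum /= => E.
  have -> : a * complex.Re (v 0 j) - b * complex.Im (v 0 j) = complex.Re ((a +i* b)%C * v 0 j).
    by case: (v 0 j).
  rewrite -E; apply: eq_bigr => k _; rewrite !mxE.
  by case: (v 0 k) => c d /=; rewrite mulr0 subr0.
have yM : y *m M = b *: x + a *: y.
  apply/rowP => j; have /(congr1 (fun w : 'rV_n.+1 => complex.Im (w 0 j))) := vM.
  rewrite !mxE raddf_sum /= => E.
  have -> : b * complex.Re (v 0 j) + a * complex.Im (v 0 j) = complex.Im ((a +i* b)%C * v 0 j).
    by case: (v 0 j) => c d /=; rewrite addrC.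
  rewrite -E; apply: eq_bigr => k _; rewrite !mxE.
  by case: (v 0 k) => c d /=; rewrite mulr0 add0r.
have xy0 : (x != 0) || (y != 0).
  apply: contraNT v0; rewrite negb_or !negbK => /andP[/eqP x0 /eqP y0].
  apply/eqP/rowP => j; move/rowP/(_ j): x0; move/rowP/(_ j): y0; rewrite !mxE.
  by case: (v 0 j) => c d /= -> ->.
have sum_gt0 : 0 < g x x + g y y.
  by case/orP: xy0 => /g_gt0 h; [have := inner_ge0 y | have := inner_ge0 x]; lra.
have b0 : b = 0.
  have := Msym x y; rewrite xM yM inner_Dl inner_Nl inner_Dr !inner_Zl !inner_Zr => E.
  have /eqP : b * (g x x + g y y) = 0 by lra.
  by rewrite mulf_eq0 (gt_eqF sum_gt0) orbF => /eqP.
exists a; first by rewrite b0.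
have h (w : 'rV_n.+1) : w *m M = a *: w -> w != 0 -> 0 < a.
  move=> wM w0; have := Mpos w0; rewrite wM inner_Zl => ?.
  by rewrite -(pmulr_lgt0 _ (g_gt0 w0)).
case/orP: xy0 => w0; apply: h w0.
- by rewrite xM b0 scale0r subr0.
- by rewrite yM b0 scale0r add0r.
Qed.

Lemma horner_mx_sym (p : {poly R}) u v :
  g (u *m horner_mx M p) v = g u (v *m horner_mx M p).
Proof.
elim/poly_ind: p u v => [|p c IH] u v.
  by rewrite !rmorph0 !mulmx0 inner_0l gC inner_0l.
rewrite rmorphD rmorphM /= horner_mx_X horner_mx_C !mulmxDr inner_Dl inner_Dr.
rewrite !mul_mx_scalar inner_Zl inner_Zr; congr (_ + _).
rewrite -!mulmxE mulmxA Msym IH; congr (g u _).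
have -> : horner_mx M p *m M = M *m horner_mx M p.
  by have := comm_mx_horner p (comm_mx_refl M) => /esym.
by rewrite mulmxA.
Qed.

(** Diagonalizability, stated as an annihilating polynomial with simple roots. With p the product
    over the distinct roots, p(M) is nilpotent by Cayley-Hamilton and symmetric, hence zero. *)
Lemma symmetric_annihilator : exists s : seq R,
  [/\ uniq s, forall a, a \in s -> 0 < a
    & horner_mx M (\prod_(a <- s) ('X - a%:P)) = 0].
Proof.
have [rs Ers] := closed_field_poly_normal (map_poly (real_complex R) (char_poly M)).
have lc : lead_coef (map_poly (real_complex R) (char_poly M)) = 1.
  by rewrite lead_coef_map (monicP (char_poly_monic M)) rmorph1.
rewrite lc scale1r in Ers.
have rsP z : z \in rs -> exists2 a : R, z = a%:C%C & 0 < a.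
  by move=> zrs; apply: char_poly_root_pos; rewrite Ers root_prod_XsubC.
pose s := undup [seq complex.Re z | z <- rs].
exists s; split; first exact: undup_uniq.
  move=> a; rewrite mem_undup => /mapP[z zrs ->].
  by have [b -> b0] := rsP _ zrs.
set p := \prod_(a <- s) _.
(* One factor [p] for each root counted with multiplicity is enough, since every root is a root of
   [p]. *)
have dvd : char_poly M %| p ^+ size rs.
  rewrite -(dvdp_map (real_complex R)) Ers rmorphXn /= -(size_map id rs) map_id.
  have H z : z \in rs -> 'X - z%:P %| map_poly (real_complex R) p.
    move=> zrs; have [b Ez b0] := rsP _ zrs.
    rewrite dvdp_XsubCl Ez /root horner_map fmorph_eq0.
    rewrite -/(root _ _) /p root_prod_XsubC mem_undup.
    by apply/mapP; exists z => //; rewrite Ez.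
  elim: (rs) H => [|z t IH] H; first by rewrite big_nil expr0 dvdpp.
  rewrite big_cons /= exprS dvdp_mul ?H ?mem_head// IH// => w wt.
  by rewrite H// inE wt orbT.
have nil : (horner_mx M p) ^+ size rs = 0.
  rewrite -rmorphXn /=; case/dvdpP: dvd => q ->.
  by rewrite rmorphM /= Cayley_Hamilton mulr0.
(* Exponents are halved by g (u S) (u S) = g u (u S S), whence the powers of 2. *)
have pw k : (horner_mx M p) ^+ (2 ^ k) = 0 -> horner_mx M p = 0.
  elim: k => [|k IH]; first by rewrite expr1.
  rewrite expnS mulnC exprM => sq0; apply: IH.
  move: sq0; rewrite -rmorphXn /=; set S := horner_mx M _ => SS0.
  apply/row_matrixP => i; rewrite row0 rowE; apply/eqP.
  by rewrite -inner_eq0 horner_mx_sym -mulmxA mulmxE -expr2 SS0 mulmx0 gC inner_0l.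
apply: (pw (size rs)).
have /subnK <- : (size rs <= 2 ^ size rs)%N by apply/ltnW/ltn_expl.
by rewrite exprD nil mulr0.
Qed.
End Symmetric.
End InnerProduct.

(** * Eigenvector decomposition and polynomial interpolation *)

Section Eigen.
Context {F : fieldType} {n : nat} (M : 'M[F]_n.+1).

Lemma horner_mx_eigen (u : 'rV_n.+1) a (p : {poly F}) :
  u *m M = a *: u -> u *m horner_mx M p = p.[a] *: u.
Proof.
move=> uM; elim/poly_ind: p => [|p c IH].
  by rewrite rmorph0 mulmx0 horner0 scale0r.
rewrite rmorphD rmorphM /= horner_mx_X horner_mx_C mulmxDr -mulmxE mulmxA IH.
by rewrite -scalemxAl uM mul_mx_scalar scalerA -scalerDl !hornerE.
Qed.

(** Each [f a] may be zero. The component for the head [a] is w = u P(M) / P(a), with P the product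
    over the tail: X - a kills it because (X - a) P kills [u], and P kills u - w because P(M) acts
    on [w] as P(a). *)
Lemma eigen_decomposition (s : seq F) (u : 'rV[F]_n.+1) : uniq s ->
  u *m horner_mx M (\prod_(a <- s) ('X - a%:P)) = 0 ->
  exists2 f : F -> 'rV[F]_n.+1, u = \sum_(a <- s) f a
    & forall a, a \in s -> f a *m M = a *: f a.
Proof.
elim: s u => [|a s IH] u /=.
  by rewrite !big_nil rmorph1 mulmx1 => _ ->; exists (fun=> 0); rewrite ?big_nil.
case/andP=> as_ us; rewrite big_cons; set P := \prod_(_ <- s) _ => uP.
have Pa : P.[a] != 0 by rewrite -/(root P a) root_prod_XsubC.
pose w := P.[a]^-1 *: (u *m horner_mx M P).
have wM : w *m M = a *: w.
  apply/eqP; rewrite -subr_eq0 -mul_mx_scalar -mulmxBr /w -scalemxAl -mulmxA.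
  rewrite [_ *m (_ - _)](_ : _ = horner_mx M (P * ('X - a%:P))).
    by rewrite mulrC uP scaler0.
  by rewrite rmorphM /= rmorphB /= horner_mx_X horner_mx_C.
have [f Ef fM] : exists2 f : F -> 'rV[F]_n.+1, u - w = \sum_(a <- s) f a
    & forall a, a \in s -> f a *m M = a *: f a.
  apply: IH => //; rewrite mulmxBl.
  rewrite -/P (horner_mx_eigen _ wM) /w scalerA divff// scale1r; exact: subrr.
exists (fun b => if b == a then w else f b).
  rewrite big_cons eqxx -[LHS](subrK w) Ef addrC; congr (_ + _).
  apply: eq_big_seq => b bs; case: eqP => // E; by rewrite E (negPf as_) in bs.
move=> b; rewrite inE; case: eqP => [-> //|_ /=]; exact: fM.
Qed.

(** Newton's scheme: the correction is a multiple of [P], which vanishes at the nodes already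
    treated. *)
Lemma interpolation (s : seq F) (h : F -> F) : uniq s ->
  exists q : {poly F}, forall a, a \in s -> q.[a] = h a.
Proof.
elim: s => [|a s IH] /=; first by exists 0.
case/andP=> as_ /IH[q qs]; set P := \prod_(b <- s) ('X - b%:P).
have Pa : P.[a] != 0 by rewrite -/(root P a) root_prod_XsubC.
exists (q + ((h a - q.[a]) / P.[a]) *: P) => b; rewrite inE !hornerE.
case/orP => [/eqP->|bs]; first by rewrite divfK// subrKC.
have /eqP -> : P.[b] == 0 by rewrite -/(root P b) root_prod_XsubC.
by rewrite mulr0 addr0 qs.
Qed.
End Eigen.

(** * The Killing-Yano identity on a 2-step nilpotent Lie algebra *)

Section KillingYanoAlgebra.
Context {R : realType} {n : nat}.
Variables (g : 'rV[R]_n.+1 -> 'rV[R]_n.+1 -> R)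
  (br : 'rV[R]_n.+1 -> 'rV[R]_n.+1 -> 'rV[R]_n.+1) (T : 'M[R]_n.+1).
Hypothesis gC : forall u v, g u v = g v u.
Hypothesis gP : forall a u v w, g (a *: u + v) w = a * g u w + g v w.
Hypothesis g_gt0 : forall v, v != 0 -> 0 < g v v.
Hypothesis brP : forall a u v w, br (a *: u + v) w = a *: br u w + br v w.
Hypothesis brN : forall u v, br u v = - br v u.
Hypothesis br_nil : forall u v w, br (br u v) w = 0.
Hypothesis Tskew : forall u v, g (u *m T) v = - g u (v *m T).
Hypothesis Tunit : T \in unitmx.
(** Twice the symmetrized Killing-Yano equation, paired with [w], after the Koszul formula has
    eliminated the connection. *)
Hypothesis KY : forall x y w,
  g (br x (y *m T)) w + g (br w (y *m T)) x + g (br w x) (y *m T)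
  + g (br y (x *m T)) w + g (br w (x *m T)) y + g (br w y) (x *m T)
  = - (2 * (g (br (w *m T) x) y + g (br (w *m T) y) x)).

Let g0l w : g 0 w = 0. Proof. exact: (inner_0l gP). Qed.
Let central z := forall x, br z x = 0.
Let centralr z x : central z -> br x z = 0.
Proof. by move=> cz; rewrite brN cz oppr0. Qed.

(** For central z and w a single term survives on each side: g [x, Tz] w = 2 g [x, Tw] z. Using this
    twice, with z and w exchanged, gives g [x, Tz] w = 4 g [x, Tz] w, so it vanishes; nilpotency
    allows w = [x, Tz]. *)
Lemma killing_yano_central z : central z -> central (z *m T).
Proof.
have key x w z' : central z' -> central w ->
    g (br x (z' *m T)) w = 2 * g (br x (w *m T)) z'.
  move=> cz cw; have := KY x z' w.
  rewrite !cw !cz !(centralr _ cz) !g0l (brN (w *m T)) (inner_Nl gP); lra.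
move=> cz x; rewrite brN; apply/eqP; rewrite oppr_eq0 -(inner_eq0 gP g_gt0).
set c := br x _; have cc : central c by move=> y; rewrite /c br_nil.
have h1 := key x c z cz cc; have h2 := key x z c cc cz.
by apply/eqP; rewrite -/c in h1 *; lra.
Qed.

(** [E] is the defect of T [w, x] = [w, Tx] + 2 [Tw, x]. It is central because T preserves the
    center, and substituting it in the identity leaves g E E = 0. Antisymmetry gives also T [w, x] =
    [Tw, x] + 2 [w, Tx], and the two formulas are compared. *)
Lemma killing_yano_commutes w x : br (w *m T) x = br w (x *m T) /\ br w x *m T = 3 *: br (w *m T) x.
Proof.
have key w' x' : br w' x' *m T = br w' (x' *m T) + 2 *: br (w' *m T) x'.
  apply/eqP; rewrite -subr_eq0 -oppr_eq0 opprB; set E := _ - _.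
  have cE : central E.
    move=> y; rewrite /E -scaleN1r addrC brP killing_yano_central; last exact: br_nil.
    rewrite scaler0 add0r addrC brP !br_nil; exact: (eq_trans (addr0 _) (scaler0 _ _)).
  have := KY x' E w'.
  rewrite !(centralr _ (killing_yano_central cE)) !cE !(centralr _ cE) !g0l => K.
  rewrite -(inner_eq0 gP g_gt0) {1}/E.
  rewrite (inner_Dl gP) (inner_Nl gP) (inner_Dl gP) (inner_Zl gP) Tskew; apply/eqP; lra.
have k1 := key w x; have k2 := key x w.
have k3 : br w x *m T = br (w *m T) x + 2 *: br w (x *m T).
  by rewrite brN mulNmx k2 opprD -scalerN (brN x) opprK (brN (x *m T)) opprK.
have e : br w (x *m T) = br (w *m T) x.
  by apply/rowP=> j; have /rowP/(_ j) := etrans (esym k3) k1; rewrite !mxE; lra.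
split=> //; rewrite k1 e -{1}[br _ _]scale1r -scalerDl; congr (_ *: _); ring.
Qed.

Theorem killing_yano_polar : exists r : {poly R}, let J := horner_mx T r in
  [/\ J *m J = - 1%:M, forall u v, br u v *m J = br (u *m J) v
    & forall u v, g (u *m J) (v *m J) = g u v].
Proof.
pose M := - (T *m T).
have Msym u v : g (u *m M) v = g u (v *m M).
  by rewrite !mulmxN (inner_Nl gP) (inner_Nr gC gP) !mulmxA !Tskew gC Tskew gC opprK.
have Mpos v : v != 0 -> 0 < g (v *m M) v.
  move=> v0; rewrite mulmxN (inner_Nl gP) mulmxA Tskew opprK g_gt0//.
  by apply: contraNN v0 => /eqP E; rewrite -[v](mulmxK Tunit) E mul0mx.
have [s [us s_gt0 sM]] := symmetric_annihilator gC gP g_gt0 Msym Mpos.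
(* On the eigenspace of [M] for a, q(M) acts as 1 / sqrt a, so that [Q] below is M^(-1/2). *)
have [q qs] := interpolation (fun a => (Num.sqrt a)^-1) us.
have dec u : exists2 f : R -> 'rV[R]_n.+1, u = \sum_(a <- s) f a
    & forall a, a \in s -> f a *m M = a *: f a.
  by apply: eigen_decomposition; rewrite // sM mulmx0.
have eig_s (u : 'rV_n.+1) a : u *m M = a *: u -> u != 0 -> a \in s.
  move=> uM u0; have := horner_mx_eigen (\prod_(a <- s) ('X - a%:P)) uM.
  rewrite sM mulmx0 => /esym/eqP; rewrite scaler_eq0 (negPf u0) orbF.
  by rewrite -/(root _ a) root_prod_XsubC.
pose Q := horner_mx M q; pose J := T *m Q.
have QQM (u : 'rV_n.+1) : u *m Q *m Q *m M = u.
  have [f -> fM] := dec u; rewrite !mulmx_suml; apply: eq_big_seq => a as_.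
  rewrite (horner_mx_eigen _ (fM a as_)) -scalemxAl (horner_mx_eigen _ (fM a as_)).
  rewrite -!scalemxAl fM// !scalerA qs// -invfM -expr2 sqr_sqrtr ?(ltW (s_gt0 _ as_))//.
  by rewrite mulVf ?scale1r// gt_eqF ?s_gt0.
(* Substituting M = - T^2 turns T q(M) into a polynomial in T alone. *)
have JE : horner_mx T ('X * (q \Po (- 'X^2))) = J.
  rewrite rmorphM /= horner_mx_X /J /Q -mulmxE; congr (_ *m _).
  elim/poly_ind: q {qs Q J QQM} => [|p c IH]; first by rewrite comp_poly0 !rmorph0.
  rewrite comp_poly_MXaddC !rmorphD !rmorphM /= IH !horner_mx_C horner_mx_X rmorphN /=.
  by rewrite rmorphXn /= horner_mx_X expr2.
have MT : M *m T = T *m M by rewrite mulNmx mulmxN mulmxA.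
have QT : Q *m T = T *m Q by apply/esym; apply: comm_mx_horner; apply/esym.
have MQ : M *m Q = Q *m M by exact: comm_mx_horner.
have J2 : J *m J = - 1%:M.
  rewrite /J mulmxA -(mulmxA T) QT mulmxA -[T *m T]opprK -/M 2!mulNmx MQ -mulmxA MQ.
  by rewrite mulmxA; congr (- _); apply/row_matrixP => i; rewrite !rowE !mulmxA QQM mulmx1.
have brM u v : br u v *m M = 9 *: br (u *m M) v.
  have K w x := (killing_yano_commutes w x).2.
  rewrite mulmxN mulmxA K -scalemxAl K scalerA mulmxN mulmxA -scaleN1r.
  have -> : br (- (u *m T *m T)) v = - br (u *m T *m T) v.
    have := brP (-1) (u *m T *m T) 0 v; rewrite addr0 !scaleN1r => ->.
    have -> : br 0 v = 0; last by rewrite addr0.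
    by have := brP (-1) 0 0 v; rewrite !scaleN1r oppr0 addr0 addNr.
  by rewrite scalerN scaleN1r; congr (- (_ *: _)); ring.
have br0 v : br 0 v = 0 by have := brP (-1) 0 0 v; rewrite !scaleN1r oppr0 addr0 addNr.
have brD u w v : br (u + w) v = br u v + br w v.
  by have := brP 1 u w v; rewrite !scale1r.
have brZ a u v : br (a *: u) v = a *: br u v.
  by have := brP a u 0 v; rewrite br0 !addr0.
have brS (f : R -> 'rV_n.+1) v : br (\sum_(a <- s) f a) v = \sum_(a <- s) br (f a) v.
  by elim/big_rec2: _ => [|a x y _ IH]; rewrite ?br0// brD IH.
(* If [f a, v] is nonzero, it is an eigenvector of [M] for 9 a. Then 9 a is an interpolation node
   and [Q] acts there as 1 / (3 sqrt a); this 1/3 cancels the 3 coming from T. *)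
have brQ u v : br u v *m Q = 3^-1 *: br (u *m Q) v.
  have [f -> fM] := dec u; rewrite mulmx_suml !brS mulmx_suml scaler_sumr.
  apply: eq_big_seq => a as_; rewrite (horner_mx_eigen _ (fM a as_)) brZ.
  have bM : br (f a) v *m M = (9 * a) *: br (f a) v by rewrite brM fM// brZ scalerA.
  rewrite (horner_mx_eigen _ bM).
  have [->|b0] := eqVneq (br (f a) v) 0; first by rewrite !scaler0.
  rewrite !qs ?(eig_s _ _ bM)// scalerA -invfM; congr (_^-1 *: _).
  rewrite sqrtrM ?ler0n//; congr (_ * _).
  have -> : 9 = 3 ^+ 2 :> R by ring.
  by rewrite sqrtr_sqr ger0_norm ?ler0n.
exists ('X * (q \Po (- 'X^2))); rewrite JE /=; split=> // u v.
  rewrite /J mulmxA (killing_yano_commutes u v).2 -scalemxAl brQ scalerA divff ?pnatr_eq0// scale1r.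
  by rewrite mulmxA.
have Jskew w z : g (w *m J) z = - g w (z *m J).
  by rewrite /J mulmxA (horner_mx_sym gC gP Msym) Tskew -mulmxA QT.
by rewrite Jskew -mulmxA J2 mulmxN mulmx1 (inner_Nr gC gP) opprK.
Qed.
End KillingYanoAlgebra.

(** * Differential calculus *)

Section Calculus.
Context {R : realType}.

Lemma is_diff_ex (V W : normedModType R) (f df : V -> W) x :
  is_diff x f df -> differentiable f x.
Proof. by case. Qed.

Lemma is_diff_val (V W : normedModType R) (f df : V -> W) x :
  is_diff x f df -> 'd f x = df :> (V -> W).
Proof. by case. Qed.

Lemma is_diff_unique (V W : normedModType R) (f d1 d2 : V -> W) x h :
  is_diff x f d1 -> is_diff x f d2 -> d1 h = d2 h.
Proof. by move=> [_ <-] [_ <-]. Qed.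

Lemma near_eq_is_diff (V W : normedModType R) (f g : V -> W) x :
  (\near x, f x = g x) -> differentiable f x -> is_diff x g ('d f x).
Proof.
move=> fg df; have fgx : f x = g x by exact: nbhs_singleton fg.
have E : g \o shift x = cst (g x) + 'd f x +o_ 0 id.
  apply/eqaddoP => e e0.
  have /eqaddoP/(_ e e0) H := diff_locally df.
  have : \forall y \near (0 : V), f (y + x) = g (y + x).
    by move: fg; rewrite (near_shift 0 x) /= subr0.
  move=> H0; apply: filterS2 H H0 => y + h2.
  by rewrite !fctE /= h2 fgx.
have dg := diff_unique (@diff_continuous _ _ _ _ _ df) E.
by apply: DiffDef => //; apply/diff_locallyP; rewrite dg; split=> //; exact: diff_continuous.
Qed.

Lemma is_diff_near (V W : normedModType R) (f g df : V -> W) x :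
  (\near x, f x = g x) -> is_diff x f df -> is_diff x g df.
Proof. by move=> fg [dfx <-]; exact: near_eq_is_diff. Qed.

Lemma near_eq_differentiable (V W : normedModType R) (f g : V -> W) x :
  (\near x, f x = g x) -> differentiable f x -> differentiable g x.
Proof. by move=> fg df; apply: (is_diff_ex (near_eq_is_diff fg df)). Qed.

Lemma near_eq_diff (V W : normedModType R) (f g : V -> W) x :
  (\near x, f x = g x) -> differentiable f x -> 'd g x = 'd f x :> (V -> W).
Proof. by move=> fg df; apply: (is_diff_val (near_eq_is_diff fg df)). Qed.

Lemma diff_near (V W : normedModType R) (f g df : V -> W) x h :
  (\near x, f x = g x) -> is_diff x f df -> 'd g x h = df h.
Proof. by move=> fg /(is_diff_near fg) H; rewrite (is_diff_val H). Qed.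

Lemma differentiableZf (V W : normedModType R) (k : V -> R) (f : V -> W) x :
  differentiable k x -> differentiable f x ->
  is_diff x (fun y => k y *: f y) (fun h => 'd k x h *: f x + k x *: 'd f x h).
Proof.
move=> dk df.
have bil : bilinear_for (GRing.Scale.Law.clone _ _ *:%R _) (GRing.Scale.Law.clone _ _ *:%R _)
    (@GRing.scale R W).
  by split=> [u'|u] a y z /=; rewrite ?scalerDl ?scalerDr ?scalerA// mulrC.
pose bM := bilinear_isBilinear.Build R R W W _ _ (@GRing.scale R W) bil.
pose B : {bilinear R -> W -> W} := HB.pack (@GRing.scale R W) bM.
have Bc : continuous (fun p => B p.1 p.2) by move=> p; exact: scale_continuous.
have dB := differentiable_bilin (k x, f x) Bc.
have dkf := differentiable_pair dk df.
apply: DiffDef; first exact: (@differentiable_comp _ _ _ _ _ (fun p => B p.1 p.2) x dkf dB).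
rewrite [LHS](@diff_comp _ _ _ _ _ (fun p => B p.1 p.2) x dkf dB).
by rewrite diff_pair// diff_bilin//; apply/funext => h /=; rewrite addrC.
Qed.

Lemma linear_sum_delta (W : normedModType R) (n : nat) (A : 'rV[R]_n -> W) w :
  linear A -> A w = \sum_j w 0 j *: A (delta_mx 0 j).
Proof.
move=> Al.
pose AM := GRing.isLinear.Build _ _ _ _ _ Al.
pose B : {linear 'rV[R]_n -> W} := HB.pack A AM.
rewrite -[A]/(B : _ -> _) {1}(row_sum_delta w) linear_sum.
by under eq_bigr do rewrite linearZ.
Qed.

Lemma is_diff_sum (V W : normedModType R) n (f : 'I_n -> V -> W) df (x : V) :
  (forall i, is_diff x (f i) (df i)) ->
  is_diff x (fun y => \sum_(i < n) f i y) (fun h => \sum_(i < n) df i h).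
Proof.
move=> H; have -> : (fun y => \sum_(i < n) f i y) = \sum_(i < n) f i.
  by apply/funext => y; rewrite fct_sumE.
have -> : (fun y => \sum_(i < n) df i y) = \sum_(i < n) df i.
  by apply/funext => y; rewrite fct_sumE.
elim: n f df H => [|n IH] f df H; first by rewrite !big_ord0; exact: is_diff_cst.
by rewrite !big_ord_recl; apply: is_diffD; apply: IH.
Qed.

Lemma is_diff_coord (V : normedModType R) n (w dw : V -> 'rV[R]_n) x j :
  is_diff x w dw -> is_diff x (fun y => w y 0 j) (fun h => dw h 0 j).
Proof.
move=> wx.
have @f : {linear 'rV[R]_n -> R}.
  by exists (fun N : 'M[R]_(_, _) => N 0 j); do 2![eexists]; do ?[constructor];
     rewrite ?mxE// => ? *; rewrite ?mxE//; move=> ?; rewrite !mxE.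
have fc : continuous f by exact: coord_continuous.
apply: (@is_diff_comp _ _ _ _ w dw f f x wx).
by apply: DiffDef; [exact: linear_differentiable|exact: diff_lin].
Qed.

(** The Leibniz rule for a family of linear maps applied to a moving vector. Expanding [w] in the
    standard basis reduces it to products with scalar functions, so only each [A^~ v] has to be
    differentiable and no topology on linear maps is involved. *)
Lemma is_diff_app (V W : normedModType R) n (A : V -> 'rV[R]_n -> W)
    (D : 'rV[R]_n -> V -> W) (w dw : V -> 'rV[R]_n) x :
  (\forall y \near x, linear (A y)) ->
  (forall v, is_diff x (A^~ v) (D v)) -> is_diff x w dw ->
  is_diff x (fun y => A y (w y)) (fun h => D (w x) h + A x (dw h)).
Proof.
move=> Alin dA wx.
have term j := differentiableZf (is_diff_ex (is_diff_coord j wx))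
  (is_diff_ex (dA (delta_mx 0 j))).
have H := is_diff_sum term.
have nA : \forall y \near x, \sum_j w y 0 j *: A y (delta_mx 0 j) = A y (w y).
  by near do rewrite -linear_sum_delta//.
have C := is_diff_sum (fun j => is_diffZ (w x 0 j) (dA (delta_mx 0 j))).
have nC : \forall y \near x, \sum_j (w x 0 j *: A^~ (delta_mx 0 j)) y = A y (w x).
  by near do rewrite [RHS]linear_sum_delta//.
apply: is_diff_eq (is_diff_near nA H) _; apply/funext => h.
rewrite -(is_diff_unique h (is_diff_near nC C) (dA (w x))).
rewrite (linear_sum_delta (dw h) (nbhs_singleton Alin)) addrC -big_split /=.
apply: eq_bigr => j _.
by rewrite (is_diff_val (is_diff_coord j wx)) (is_diff_val (dA (delta_mx 0 j))).
Unshelve. all: by end_near. Qed.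

End Calculus.

(** * Mean value theorem and symmetry of second derivatives *)

Section SecondDerivative.
Context {R : realType}.

Lemma is_derive_line (V W : normedModType R) (f : V -> W) (a v : V) (t : R) :
  differentiable f (a + t *: v) ->
  is_derive t 1 (fun s => f (a + s *: v)) ('d f (a + t *: v) v).
Proof.
move=> df.
have dl : is_diff t (fun s => a + s *: v) (fun h => h *: v).
  have -> : (fun h : R => h *: v) = 0 + ( *:%R^~ v) by apply/funext => h; rewrite !fctE add0r.
  exact: is_diffD.
have := @is_diff_comp _ _ _ _ (fun s : R => a + s *: v) (fun h => h *: v)
  f ('d f (a + t *: v)) t dl (differentiableP df).
move=> H; have dc := is_diff_ex H.
apply: DeriveDef; first exact: diff_derivable.
rewrite deriveE//; rewrite (is_diff_val H) /=.
by rewrite scale1r.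
Qed.

Lemma MVT_line (V : normedModType R) (f : V -> R) (a v : V) (t : R) : 0 <= t ->
  (forall s, 0 <= s <= t -> differentiable f (a + s *: v)) ->
  exists2 s, 0 <= s <= t & f (a + t *: v) - f a = t * 'd f (a + s *: v) v.
Proof.
move=> t0 df.
have [s||s sI E] := @MVT_segment R (fun s => f (a + s *: v)) (fun s => 'd f (a + s *: v) v) 0 t t0.
- rewrite in_itv /= => /andP[s0 st]; apply: is_derive_line.
  by apply: df; rewrite !ltW.
- apply: derivable_within_continuous => s; rewrite in_itv /= => sI.
  by have [] := is_derive_line (df s sI).
- exists s; first by rewrite in_itv in sI.
  by move: E; rewrite scale0r addr0 subr0 mulrC.
Qed.

(** The mean value theorem in the direction [u], applied to the increment of [f] along t v, leaves a
    difference of first derivatives, which the differential of [P] at [x] approximates. Second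
    derivatives are used only at [x], and their continuity does not enter. *)
Lemma second_difference (V : normedModType R) (f : V -> R) (x u v : V) :
  (\forall y \near x, differentiable f y) ->
  differentiable (fun y => 'd f y u) x ->
  forall e, 0 < e -> \forall t \near 0^'+,
    `|f (x + t *: v + t *: u) - f (x + t *: v) - (f (x + t *: u) - f x)
      - t ^+ 2 * 'd (fun y => 'd f y u) x v| <= e * t ^+ 2.
Proof.
move=> df dP e e0; set P := fun y => 'd f y u.
(* The two errors are proportional to |t v + s u| and |s u|, whose sum is at most t (2 |u| + |v|);
   the summand 1 keeps [C] positive. *)
pose C := 2 * `|u| + `|v| + 1.
have C0 : 0 < C by rewrite /C; have := normr_ge0 u; have := normr_ge0 v; lra.
have /eqaddoP/(_ (e / C) (divr_gt0 e0 C0)) := diff_locally dP.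
move=> /nbhs_ballP[r1 /= r10 H1].
have /nbhs_ballP[r2 /= r20 H2] := df.
have r0 : 0 < Num.min r1 r2 by rewrite lt_min r10.
near=> t.
have t0 : 0 < t by near: t; exact: nbhs_right_gt.
have tr : t * C < Num.min r1 r2.
  rewrite -ltr_pdivlMr//; near: t; apply: nbhs_right_lt; exact: divr_gt0.
have small s : 0 <= s <= t -> `|s *: u| <= t * `|u| /\ `|t *: v + s *: u| <= t * (`|u| + `|v|).
  move=> /andP[s0 st]; have st' : `|s *: u| <= t * `|u|.
    by rewrite normrZ ger0_norm// ler_wpM2r.
  split=> //; apply: le_trans (ler_normD _ _) _.
  rewrite mulrDr addrC lerD// normrZ gtr0_norm//.
have nu := normr_ge0 u; have nv := normr_ge0 v.
have sm1 s : 0 <= s <= t -> `|s *: u| < Num.min r1 r2 /\ `|t *: v + s *: u| < Num.min r1 r2.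
  move=> sI; have [h1 h2] := small s sI; split; apply: le_lt_trans tr.
    by apply: le_trans h1 _; rewrite ler_pM2l// /C; lra.
  by apply: le_trans h2 _; rewrite ler_pM2l// /C; lra.
have dfx k : `|k| < Num.min r1 r2 -> differentiable f (x + k).
  rewrite lt_min => /andP[_ kr]; apply: H2; rewrite -ball_normE /=.
  by rewrite opprD addNKr normrN.
have dPx k : `|k| < Num.min r1 r2 -> `|P (x + k) - P x - 'd P x k| <= e / C * `|k|.
  rewrite lt_min => /andP[kr _]; have := H1 k; rewrite -ball_normE /= sub0r normrN => /(_ kr).
  by rewrite !fctE /= opprD addrA (addrC k x).
pose h y := f (y + t *: v) - f y.
have dsh y : differentiable f (y + t *: v) -> is_diff y (f \o (+%R^~ (t *: v))) ('d f (y + t *: v)).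
  move=> dfy.
  have dl : is_diff y (+%R^~ (t *: v)) id.
    rewrite (_ : id = id + 0); last by apply/funext => z; rewrite !fctE addr0.
    exact: is_diffD.
  exact: (is_diff_comp dl (differentiableP dfy)).
have dh s : 0 <= s <= t -> is_diff (x + s *: u) h
    (fun k => 'd f (x + (t *: v + s *: u)) k - 'd f (x + s *: u) k).
  move=> /sm1[/dfx h1 /dfx h2].
  have E : x + s *: u + t *: v = x + (t *: v + s *: u) by rewrite -addrA (addrC (s *: u)).
  have := @is_diffB _ _ _ _ _ _ _ (x + s *: u) (dsh (x + s *: u) _) (differentiableP h1).
  by rewrite E; exact.
have [|s sI] := @MVT_line V h x u t (ltW t0).
  by move=> s /dh dhs; apply: (is_diff_ex dhs).
rewrite (is_diff_val (dh s sI)) /h => E.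
rewrite (addrAC x (t *: v)).
have [k1 k2] := small s sI; have [/dPx p1 /dPx p2] := sm1 s sI.
have -> : f (x + t *: u + t *: v) - f (x + t *: v) - (f (x + t *: u) - f x) =
    t * (P (x + (t *: v + s *: u)) - P (x + s *: u)).
  by rewrite -E; ring.
have linD : 'd P x (t *: v + s *: u) = t * 'd P x v + 'd P x (s *: u).
  by rewrite linearD linearZ.
rewrite linD in p2.
have -> : t * (P (x + (t *: v + s *: u)) - P (x + s *: u)) - t ^+ 2 * 'd P x v
  = t * ((P (x + (t *: v + s *: u)) - P x - (t * 'd P x v + 'd P x (s *: u)))
         - (P (x + s *: u) - P x - 'd P x (s *: u))) by ring.
rewrite normrM gtr0_norm// expr2 mulrCA ler_pM2l//.
apply: le_trans (ler_normB _ _) _; apply: le_trans (lerD p2 p1) _.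
rewrite -mulrDr -mulrA ler_pM2l// ler_pdivrMl// mulrC (le_trans (lerD k2 k1))//.
rewrite -mulrDr ler_pM2l// /C; lra.
Unshelve. all: by end_near. Qed.

(** The second difference of [f] is symmetric in [u] and [v], and t^2 times either mixed derivative
    approximates it up to an arbitrarily small multiple of t^2. *)
Lemma schwarz_scalar (V : normedModType R) (f : V -> R) (x u v : V) :
  (\forall y \near x, differentiable f y) ->
  differentiable (fun y => 'd f y u) x -> differentiable (fun y => 'd f y v) x ->
  'd (fun y => 'd f y u) x v = 'd (fun y => 'd f y v) x u.
Proof.
move=> df du dv; apply/eqP; rewrite -subr_eq0 -normr_le0; apply/ler_addgt0Pr => e e0.
rewrite add0r; have e2 : 0 < e / 2 by rewrite divr_gt0.
near (0 : R)^'+ => t.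
have t0 : 0 < t by near: t; exact: nbhs_right_gt.
set a := 'd _ x v; set b := 'd _ x u.
have h1 : `|f (x + t *: v + t *: u) - f (x + t *: v) - (f (x + t *: u) - f x) - t ^+ 2 * a|
    <= e / 2 * t ^+ 2 by near: t; exact: second_difference.
have h2 : `|f (x + t *: u + t *: v) - f (x + t *: u) - (f (x + t *: v) - f x) - t ^+ 2 * b|
    <= e / 2 * t ^+ 2 by near: t; exact: second_difference.
move: h1 h2; rewrite (addrAC x (t *: u)).
set F := f (x + _ + _); set F1 := f (x + t *: u); set F2 := f (x + t *: v); set F0 := f x.
move=> h1 h2; have t2 : 0 < t ^+ 2 by rewrite exprn_gt0.
rewrite -(ler_pM2l t2) -[X in X * `|_|]gtr0_norm// -normrM.
have -> : t ^+ 2 * (a - b) = (F - F1 - (F2 - F0) - t ^+ 2 * b) - (F - F2 - (F1 - F0) - t ^+ 2 * a).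
  by ring.
by apply: le_trans (ler_normB _ _) _; have := lerD h2 h1; lra.
Unshelve. all: by end_near. Qed.
End SecondDerivative.

(** * Smooth maps on open sets *)

Section Smooth.
Context {R : realType}.

Lemma smooth_differentiable (V W : normedModType R) (U : set V) (f : V -> W) x :
  smooth_on U f -> U x -> differentiable f x.
Proof. by move=> /(_ 1%N)[+ _]; apply. Qed.

Lemma smooth_derive (V W : normedModType R) (U : set V) (f : V -> W) v :
  smooth_on U f -> smooth_on U (fun x => 'D_v f x).
Proof. by move=> fs k; have [_] := fs k.+1; apply. Qed.

Lemma eq_Ck (V W : normedModType R) (U : set V) (f g : V -> W) k : open U ->
  (forall x, U x -> f x = g x) -> Ck k U f -> Ck k U g.
Proof.
move=> oU; have nU x : U x -> \forall y \near x, U y by move=> Ux; apply: open_nbhs_nbhs; split.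
elim: k f g => [|k IH] f g fg /=.
  move=> fc x Ux; have := fc x Ux.
  rewrite /prop_for /continuous_at (fg _ Ux); apply: cvg_trans.
  by apply: near_eq_cvg; near do apply: fg; exact: nU.
move=> [df Cf]; split=> [x Ux|v].
  by apply: near_eq_differentiable (df x Ux); near do apply: fg; exact: nU.
apply: IH (Cf v) => x Ux; apply: near_eq_derive.
by near do apply: fg; exact: nU.
Unshelve. all: by end_near. Qed.

Lemma subset_Ck (V W : normedModType R) (U U' : set V) (f : V -> W) k :
  (forall x, U' x -> U x) -> Ck k U f -> Ck k U' f.
Proof.
move=> sub; elim: k f => [|k IH] f /=; first by move=> fc x /sub; exact: fc.
by move=> [df Cf]; split=> [x /sub /df//|v]; apply: IH (Cf v).
Qed.

Lemma CkD (V W : normedModType R) (U : set V) (f g : V -> W) k : open U ->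
  Ck k U f -> Ck k U g -> Ck k U (fun x => f x + g x).
Proof.
move=> oU; elim: k f g => [|k IH] f g /=.
  by move=> fc gc x Ux; apply: continuousD; [exact: fc|exact: gc].
move=> [df Cf] [dg Cg]; split=> [x Ux|v].
  by apply: (@differentiableD _ _ _ f g); [exact: df|exact: dg].
apply: eq_Ck (IH _ _ (Cf v) (Cg v)) => // x Ux.
by rewrite (@deriveD _ _ _ f g)//; apply: diff_derivable; [exact: df|exact: dg].
Qed.

Lemma CkZ (V W : normedModType R) (U : set V) (f : V -> W) (a : R) k : open U ->
  Ck k U f -> Ck k U (fun x => a *: f x).
Proof.
move=> oU; elim: k f => [|k IH] f /=.
  by move=> fc x Ux; apply: (@continuousZl_tmp _ _ _ f); exact: fc.
move=> [df Cf]; split=> [x Ux|v].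
  by apply: (@differentiableZ _ _ _ f); exact: df.
apply: eq_Ck (IH _ (Cf v)) => // x Ux.
by rewrite (@deriveZ _ _ _ f)//; apply: diff_derivable; exact: df.
Qed.

(** As the differential of [A] is the constant [L], a derivative of f o A is again a derivative of f
    composed with [A], and the induction closes. It is meant for the slices of a map of two
    variables with one of them fixed. *)
Lemma Ck_comp_affine (V V' W : normedModType R) (U : set V) (f : V -> W)
    (A L : V' -> V) k : open U -> (forall x, is_diff x A L) ->
  Ck k U f -> Ck k (A @^-1` U) (f \o A).
Proof.
move=> oU AL; have dA x : differentiable A x by exact: (is_diff_ex (AL x)).
have cA : continuous A by move=> x; exact: differentiable_continuous.
have oAU : open (A @^-1` U) by apply: open_comp.
elim: k f => [|k IH] f /=.
  by move=> fc x Ux; apply: continuous_comp; [exact: cA|exact: fc].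
move=> [df Cf]; split=> [x Ux|v].
  by apply: differentiable_comp => //; exact: df.
apply: eq_Ck (IH _ (Cf (L v))) => // x Ux.
have dfx := df _ Ux.
rewrite /= !deriveE//; last exact: differentiable_comp.
by rewrite (diff_comp (dA x) dfx) /= (is_diff_val (AL x)).
Qed.

Lemma schwarz (V : normedModType R) n (f : V -> 'rV[R]_n) (U : set V) x u v :
  open U -> smooth_on U f -> U x ->
  'D_v (fun y => 'D_u f y) x = 'D_u (fun y => 'D_v f y) x.
Proof.
move=> oU fs Ux.
have nU : \forall y \near x, U y by move=> *; apply: open_nbhs_nbhs; split.
have df y : U y -> differentiable f y by exact: smooth_differentiable.
have dDf w y : U y -> differentiable (fun y => 'D_w f y) y.
  by move=> Uy; apply: smooth_differentiable Uy; exact: smooth_derive.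
rewrite (deriveE _ (dDf u x Ux)) (deriveE _ (dDf v x Ux)).
apply/rowP => i.
have comp y : U y -> is_diff y (fun z => f z 0 i) (fun h => 'd f y h 0 i).
  by move=> Uy; apply: is_diff_coord; apply: differentiableP; exact: df.
have near_comp w : \forall y \near x, 'D_w f y 0 i = 'd (fun z => f z 0 i) y w.
  near=> y; have Uy : U y by near: y.
  by rewrite (is_diff_val (comp y Uy)) deriveE//; exact: df.
have dcomp w : is_diff x (fun y => 'D_w f y 0 i) (fun h => 'd (fun y => 'D_w f y) x h 0 i).
  by apply: is_diff_coord; apply: differentiableP; exact: dDf.
have dd w := is_diff_ex (dcomp w).
have E w h : 'd (fun y => 'D_w f y) x h 0 i = 'd (fun y => 'd (fun z => f z 0 i) y w) x h.
  rewrite (near_eq_diff (near_comp w) (dd w)).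
  by rewrite (is_diff_val (dcomp w)).
rewrite !E; apply: schwarz_scalar.
- near=> y; apply: (is_diff_ex (comp y _)); by near: y.
- exact: near_eq_differentiable (near_comp u) (dd u).
- exact: near_eq_differentiable (near_comp v) (dd v).
Unshelve. all: by end_near. Qed.

(** Balls contain the segments to their center, so the mean value theorem applies to each
    component. *)
Lemma zero_diff_ball (V : normedModType R) n (f : V -> 'rV[R]_n) c r :
  (forall y, ball c r y -> is_diff y f (cst 0)) ->
  forall y, ball c r y -> f y = f c.
Proof.
move=> fd y yB; apply/rowP => i; apply/eqP; rewrite -subr_eq0; apply/eqP.
have comp z : ball c r z -> is_diff z (fun z => f z 0 i) (cst 0).
  move=> /fd zd; have := is_diff_coord i zd; congr is_diff_def.
  by apply/funext => h; rewrite mxE.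
have seg s : 0 <= s <= 1 -> ball c r (c + s *: (y - c)).
  move=> /andP[s0 s1]; move: yB; rewrite -ball_normE /= opprD addNKr normrN.
  by apply: le_lt_trans; rewrite normrZ ger0_norm// distrC ler_piMl.
have [s sI|s sI] := @MVT_line _ _ (fun z => f z 0 i) c (y - c) 1 ler01.
  by apply: (is_diff_ex (comp _ (seg s sI))).
by rewrite (is_diff_val (comp _ (seg s sI))) scale1r subrKC mulr0.
Qed.

End Smooth.

(** * Charts and differentials *)

Section Charts.
Context {R : realType} {n : nat} {N : topologicalType} (c : chart R n N).

Lemma point_dom x : chart_image c x -> dom c (point c x).
Proof. by move=> [p cp <-]; rewrite coordsK. Qed.

Lemma pointK x : chart_image c x -> coords c (point c x) = x.
Proof. by move=> [p cp <-]; rewrite coordsK. Qed.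

Lemma coords_image p : dom c p -> chart_image c (coords c p).
Proof. by exists p. Qed.

Lemma near_chart_image p : dom c p -> \forall x \near coords c p, chart_image c x.
Proof.
move=> cp; apply: open_nbhs_nbhs; split; [exact: open_image_coords|exact: coords_image].
Qed.

Lemma near_point p (P : set N) : dom c p -> nbhs p P ->
  \forall x \near coords c p, P (point c x).
Proof.
move=> cp pP; apply: (continuous_point (coords_image cp)).
by rewrite coordsK.
Qed.
End Charts.

(** * Differentials of self-maps of the group in arbitrary charts *)

Section Manifold.
Context {R : realType} {n : nat} {N : lieGroup R n}.
Local Notation tangent := 'rV[R]_n.
Local Notation "'ch' p" := (chart_at (smooth_str N) p) (at level 9, p at level 9).

Lemma near_dom a p : dom (ch a) p -> \forall q \near p, dom (ch a) q.
Proof. by move=> ap; apply: open_nbhs_nbhs; split=> //; exact: open_dom. Qed.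

Definition rep (a b : N) (F : N -> N) : tangent -> tangent :=
  coords (ch b) \o F \o point (ch a).

(** Unlike in [tangent_map], the charts need not be the preferred ones at [p] and [F p]: nearby
    points can share a chart, so the differential can itself be differentiated in the base point. *)
Definition dmap : (N -> N) -> N -> N -> N -> tangent -> tangent :=
  locked (fun F a p b => 'd (rep a b F) (coords (ch a) p)).

Lemma dmapE F a p b : dmap F a p b = 'd (rep a b F) (coords (ch a) p).
Proof. by rewrite /dmap -lock. Qed.

Lemma dmap_linear F a p b : linear (dmap F a p b).
Proof. by move=> k u v; rewrite dmapE linearP. Qed.

(** Continuity ensures that points near [p] are sent into a given chart domain around [F p], which
    the local chain rule requires. *)
Definition mdiff (F : N -> N) : Prop := continuous F /\
  forall p a b, dom (ch a) p -> dom (ch b) (F p) ->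
    differentiable (rep a b F) (coords (ch a) p).

Lemma rep_comp_near F G a b c p : continuous F ->
  dom (ch a) p -> dom (ch b) (F p) ->
  \forall x \near coords (ch a) p, (rep b c G \o rep a b F) x = rep a c (G \o F) x.
Proof.
move=> cF ap bFp; have := near_point ap (cF p _ (near_dom bFp)).
by apply: filterS => x /= bx; rewrite /rep /= coordsK.
Qed.

Lemma rep_coords F a b p : dom (ch a) p -> rep a b F (coords (ch a) p) = coords (ch b) (F p).
Proof. by move=> ap; rewrite /rep /= coordsK. Qed.

Lemma mdiff_comp F G : mdiff F -> mdiff G -> mdiff (G \o F).
Proof.
move=> [cF dF] [cG dG]; split=> [p|p a c ap cGFp].
  by apply: continuous_comp; [exact: cF|exact: cG].
have bFp := mem_chart_at (smooth_str N) (F p).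
apply: (near_eq_differentiable (rep_comp_near G c cF ap bFp)).
apply: differentiable_comp; first exact: dF.
by rewrite (rep_coords F _ ap); exact: dG.
Qed.

Lemma dmap_comp F G a p b c : mdiff F -> mdiff G ->
  dom (ch a) p -> dom (ch b) (F p) -> dom (ch c) (G (F p)) ->
  dmap (G \o F) a p c = dmap G b (F p) c \o dmap F a p b.
Proof.
move=> [cF dF] [cG dG] ap bFp cGFp; rewrite !dmapE.
have dFp : differentiable (rep a b F) (coords (ch a) p) by exact: dF.
have dGp : differentiable (rep b c G) (rep a b F (coords (ch a) p)).
  by rewrite (rep_coords F _ ap); exact: dG.
have near := rep_comp_near G c cF ap bFp.
apply: etrans (near_eq_diff near (differentiable_comp dFp dGp)) _.
by apply: etrans (diff_comp dFp dGp) _; rewrite rep_coords.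
Qed.

(** The chain rule with intermediate point and composite map given up to equations, so that group
    identities need not be rewritten inside [dmap]. *)
Lemma dmap_trans (F G H : N -> N) a p b q c v : mdiff F -> mdiff G ->
  F p = q -> H =1 G \o F -> dom (ch a) p -> dom (ch b) q -> dom (ch c) (G q) ->
  dmap H a p c v = dmap G b q c (dmap F a p b v).
Proof.
move=> dF dG Fp /funext -> ap bq cr; rewrite -Fp in bq cr *.
by rewrite (dmap_comp dF dG ap bq cr).
Qed.

Lemma mdiff_id : mdiff idfun.
Proof.
split=> [p|p a b ap bp]; first exact: cvg_id.
apply: (smooth_differentiable (@smooth_transition _ _ _ (smooth_str N) a b)).
by split; [exact: coords_image|rewrite coordsK].
Qed.

Lemma dmap_id a p : dom (ch a) p -> dmap idfun a p a = idfun.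
Proof.
move=> ap; rewrite dmapE.
have near : \forall x \near coords (ch a) p, x = rep a a idfun x.
  by apply: filterS (near_chart_image ap) => x /pointK; rewrite /rep /= => ->.
have di : is_diff (coords (ch a) p) (fun x : tangent => x) id := is_diff_id _.
by rewrite (near_eq_diff near (is_diff_ex di)) (is_diff_val di).
Qed.

Definition mulc (p q r : N) (z : tangent * tangent) : tangent :=
  coords (ch r) (point (ch p) z.1 * point (ch q) z.2)%g.

Definition mul_dom (p q r : N) : set (tangent * tangent) :=
  [set z | [/\ chart_image (ch p) z.1, chart_image (ch q) z.2
             & dom (ch r) (point (ch p) z.1 * point (ch q) z.2)%g]].

Lemma smooth_mulc p q r : smooth_on (mul_dom p q r) (mulc p q r).
Proof. exact: smooth_mul. Qed.

Lemma open_mul_dom p q r : open (mul_dom p q r).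
Proof.
rewrite openE => -[x y] [/= px qy rxy].
have c1 : {for (x, y), continuous
    (fun z : tangent * tangent => (point (ch p) z.1, point (ch q) z.2))}.
  apply: cvg_pair => /=.
  - exact: (@cvg_comp _ _ _ fst (point (ch p)) _ (nbhs x) _ cvg_fst (continuous_point px)).
  - exact: (@cvg_comp _ _ _ snd (point (ch q)) _ (nbhs y) _ cvg_snd (continuous_point qy)).
have c2 : {for (x, y), continuous
    (fun z : tangent * tangent => (point (ch p) z.1 * point (ch q) z.2)%g)}.
  have cm := @continuous_mul _ _ N (point (ch p) x, point (ch q) y).
  exact: (@cvg_comp _ _ _ _ (fun w : N * N => (w.1 * w.2)%g) _ _ _ c1 cm).
have n1 : \forall z \near (x, y), chart_image (ch p) z.1.
  have H : \forall z \near x, chart_image (ch p) z.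
    by apply: open_nbhs_nbhs; split; [exact: open_image_coords|].
  exact: (@cvg_fst _ _ (nbhs x) (nbhs y) _ _ H).
have n2 : \forall z \near (x, y), chart_image (ch q) z.2.
  have H : \forall z \near y, chart_image (ch q) z.
    by apply: open_nbhs_nbhs; split; [exact: open_image_coords|].
  exact: (@cvg_snd _ _ (nbhs x) (nbhs y) _ _ H).
have n3 : \forall z \near (x, y), dom (ch r) (point (ch p) z.1 * point (ch q) z.2)%g.
  exact: c2 (near_dom rxy).
by apply: filterS3 n1 n2 n3 => z ? ? ?; split.
Qed.

Lemma mul_dom_coords p q r a b : dom (ch p) a -> dom (ch q) b -> dom (ch r) (a * b)%g ->
  mul_dom p q r (coords (ch p) a, coords (ch q) b).
Proof. by move=> pa qb rab; split; rewrite ?coordsK//=; exact: coords_image. Qed.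

Lemma is_diff_pairl (V W : normedModType R) (x : V) (y : W) :
  is_diff y (fun y => (x, y)) (fun h => (0, h)).
Proof. exact: (is_diff_pair (is_diff_cst x y) (is_diff_id y)). Qed.

Lemma is_diff_pairr (V W : normedModType R) (x : V) (y : W) :
  is_diff x (fun x => (x, y)) (fun h => (h, 0)).
Proof. exact: (is_diff_pair (is_diff_id x) (is_diff_cst y x)). Qed.

Lemma mdiff_left a : mdiff (left_translation a).
Proof.
split=> [p|p q r qp rap].
  apply: (@continuous_comp _ _ _ (fun b => (a, b)) (fun z : N * N => (z.1 * z.2)%g)).
    by apply: cvg_pair; [exact: cvg_cst|exact: cvg_id].
  exact: continuous_mul.
have -> : rep q r (left_translation a) = mulc a q r \o (fun y => (coords (ch a) a, y)).
  by apply/funext => y; rewrite /rep /mulc /= coordsK//; exact: mem_chart_at.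
apply: differentiable_comp; first exact: (is_diff_ex (is_diff_pairl _ _)).
apply: (smooth_differentiable (@smooth_mulc a q r)).
by apply: mul_dom_coords => //; exact: mem_chart_at.
Qed.

Lemma mdiff_right a : mdiff (right_translation a).
Proof.
split=> [p|p q r qp rap].
  apply: (@continuous_comp _ _ _ (fun b => (b, a)) (fun z : N * N => (z.1 * z.2)%g)).
    by apply: cvg_pair; [exact: cvg_id|exact: cvg_cst].
  exact: continuous_mul.
have -> : rep q r (right_translation a) = mulc q a r \o (fun y => (y, coords (ch a) a)).
  by apply/funext => y; rewrite /rep /mulc /= coordsK//; exact: mem_chart_at.
apply: differentiable_comp; first exact: (is_diff_ex (is_diff_pairr _ _)).
apply: (smooth_differentiable (@smooth_mulc q a r)).
by apply: mul_dom_coords => //; exact: mem_chart_at.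
Qed.

Lemma mdiff_inv : mdiff (fun a => a^-1)%g.
Proof.
split=> [p|p q r qp rp]; first exact: continuous_inv.
apply: (smooth_differentiable (@smooth_inv _ _ N q r)).
by split; [exact: coords_image|rewrite coordsK].
Qed.

Lemma tangent_mapE F p : tangent_map F p = dmap F p p (F p).
Proof. by rewrite dmapE. Qed.

End Manifold.

(** * Left invariant vector fields *)

Section LeftInvariantFields.
Context {R : realType} {n : nat} {N : lieGroup R n}.
Local Notation tangent := 'rV[R]_n.
Local Notation "'ch' p" := (chart_at (smooth_str N) p) (at level 9, p at level 9).
Local Notation e := (1%g : N).
Local Notation c := (coords (ch e) e).
Local Notation "'L_' a" := (@left_translation R n N a) (at level 9, a at level 9).

Let dom1 : dom (ch e) e. Proof. exact: mem_chart_at. Qed.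
Hint Resolve dom1 : core.

(* [linv v] is the left invariant field with value [v] at the identity.  Like
   [dmap], [frame], [br] and [Ad], it is locked because unification would
   otherwise unfold differentials, down to the choice operator defining them. *)
Definition linv : tangent -> N -> tangent :=
  locked (fun v p => tangent_map (L_ p) e v).

(* The components of [linv v] in the chart [chart_at q]. *)
Definition frame : N -> tangent -> tangent -> tangent :=
  locked (fun q v x => 'D_(0, v) (mulc q e q) (x, c)).

Lemma frame_def q v : frame q v = fun x => 'D_(0, v) (mulc q e q) (x, c).
Proof. by rewrite /frame -lock. Qed.

Lemma linvE v p : linv v p = dmap (L_ p) e e p v.
Proof. by rewrite /linv -lock tangent_mapE /left_translation mulg1. Qed.

Lemma mul_dom_e q x : chart_image (ch q) x -> mul_dom q e q (x, c).
Proof.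
move=> qx; split=> //=; first exact: coords_image.
by rewrite coordsK// mulg1; exact: point_dom.
Qed.

Lemma frameE q v x : chart_image (ch q) x -> frame q v x = dmap (L_ (point (ch q) x)) e e q v.
Proof.
move=> qx; have dm := smooth_differentiable (@smooth_mulc _ _ _ q e q) (mul_dom_e qx).
rewrite frame_def dmapE deriveE//; set a := point (ch q) x.
have dp := is_diff_pairl x c.
have := diff_comp (is_diff_ex dp) dm.
rewrite (is_diff_val dp) => /(congr1 (@^~ v)) /= <-.
by congr ('d _ _ _).
Qed.

Lemma local_fieldE (q : N) (X : N -> tangent) x :
  local_field q X x = dmap idfun (point (ch q) x) (point (ch q) x) q (X (point (ch q) x)).
Proof. by rewrite dmapE. Qed.

Lemma local_field_center (p : N) (X : N -> tangent) : local_field p X (coords (ch p) p) = X p.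
Proof. by rewrite local_fieldE coordsK ?dmap_id//; exact: mem_chart_at. Qed.

Lemma local_field_linv q v x : chart_image (ch q) x -> local_field q (linv v) x = frame q v x.
Proof.
move=> qx; rewrite frameE// local_fieldE linvE; set a := point (ch q) x.
have qa : dom (ch q) a by exact: point_dom.
have aa : dom (ch a) a by exact: mem_chart_at.
have := @dmap_comp _ _ _ (L_ a) idfun e e a q (mdiff_left a) mdiff_id dom1.
by rewrite /left_translation mulg1 => /(_ aa qa) ->.
Qed.

(** A frame field is a partial derivative of the multiplication, restricted to the slice whose
    second variable is the identity; its smoothness is that of the multiplication. *)
Lemma smooth_frame q v : smooth_on (chart_image (ch q)) (frame q v).
Proof.
rewrite frame_def => k.
have H := @Ck_comp_affine R _ _ _ _ ('D_(0, v) (mulc q e q)) (fun x => (x, c))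
  (fun h => (h, 0)) k (@open_mul_dom _ _ _ q e q) (fun x => is_diff_pairr x c)
  (smooth_derive (0, v) (@smooth_mulc _ _ _ q e q) k).
by apply: subset_Ck H => x; exact: mul_dom_e.
Qed.

Lemma smooth_linv v : smooth_field (linv v).
Proof.
move=> q k; apply: eq_Ck (smooth_frame q v k); first exact: open_image_coords.
by move=> x qx; rewrite local_field_linv.
Qed.

Lemma differentiable_frame q v x : chart_image (ch q) x -> differentiable (frame q v) x.
Proof. exact/smooth_differentiable/smooth_frame. Qed.

Lemma frame_linear q x : chart_image (ch q) x -> linear (frame q ^~ x).
Proof. by move=> qx a u v; rewrite !frameE// dmap_linear. Qed.

Lemma frame_e v : frame e v c = v.
Proof.
rewrite frameE; last exact: coords_image.
rewrite coordsK// (_ : L_ e = idfun) ?dmap_id//.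
by apply/funext => x; rewrite /left_translation mul1g.
Qed.

Lemma linv_center p v : linv v p = frame p v (coords (ch p) p).
Proof.
rewrite -local_field_linv ?local_field_center//; apply: coords_image.
exact: mem_chart_at.
Qed.

Lemma linv_e v : linv v e = v.
Proof. by rewrite linv_center frame_e. Qed.

Lemma linv_mul a b v : linv v (a * b)%g = dmap (L_ a) b b (a * b)%g (linv v b).
Proof.
rewrite !linvE.
have Le q : L_ q e = q by rewrite /left_translation mulg1.
have Lab : L_ (a * b)%g =1 L_ a \o L_ b.
  by move=> x; rewrite /left_translation /= mulgA.
by apply: dmap_trans (mdiff_left b) (mdiff_left a) (Le b) Lab dom1 _ _; exact: mem_chart_at.
Qed.

Lemma linv_linear p : linear (linv ^~ p).
Proof. by move=> a u v; rewrite !linvE dmap_linear. Qed.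

Lemma linv0 p : linv 0 p = 0.
Proof. by have := linv_linear p (-1) 0 0; rewrite scaler0 addr0 scaleN1r addNr. Qed.

Lemma linvN p v : linv (- v) p = - linv v p.
Proof. by have := linv_linear p (-1) v 0; rewrite linv0 !addr0 !scaleN1r. Qed.

Lemma linv_surj p w : exists v, linv v p = w.
Proof.
have pp : dom (ch p) p by exact: mem_chart_at.
exists (dmap (L_ p^-1%g) p p e w); rewrite linvE.
have Lp : L_ p^-1%g p = e by rewrite /left_translation mulVg.
have Lpp : L_ p e = p by rewrite /left_translation mulg1.
have LpV : idfun =1 L_ p \o L_ p^-1%g by move=> x; rewrite /left_translation /= mulgA mulgV mul1g.
rewrite -(@dmap_trans _ _ _ (L_ p^-1%g) (L_ p) idfun p p e e p w)//; last by rewrite Lpp.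
- by rewrite dmap_id.
- exact: mdiff_left.
- exact: mdiff_left.
Qed.

Lemma bracket_linv u v p : bracket (linv u) (linv v) p =
  'd (frame p v) (coords (ch p) p) (linv u p) - 'd (frame p u) (coords (ch p) p) (linv v p).
Proof.
have pp : dom (ch p) p by exact: mem_chart_at.
have dfr w : differentiable (frame p w) (coords (ch p) p).
  by apply: differentiable_frame; exact: coords_image.
have E w h : 'D_h (local_field p (linv w)) (coords (ch p) p)
    = 'd (frame p w) (coords (ch p) p) h.
  rewrite -deriveE//; apply: near_eq_derive.
  by apply: filterS (near_chart_image pp) => x /local_field_linv.
by rewrite /bracket !E.
Qed.

Definition br : tangent -> tangent -> tangent :=
  locked (fun u v => bracket (linv u) (linv v) e).

Lemma br_def u v : br u v = bracket (linv u) (linv v) e.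
Proof. by rewrite /br -lock. Qed.

Lemma brE u v : br u v = 'd (frame e v) c u - 'd (frame e u) c v.
Proof. by rewrite br_def bracket_linv !linv_e. Qed.

Lemma brN u v : br u v = - br v u.
Proof. by rewrite !brE opprB. Qed.

Lemma diff_frame_linear a u v h :
  'd (frame e (a *: u + v)) c h = a *: 'd (frame e u) c h + 'd (frame e v) c h.
Proof.
have dfr w : differentiable (frame e w) c.
  by apply: differentiable_frame; exact: coords_image.
have H : is_diff c (fun x => a *: frame e u x + frame e v x)
    (fun h => a *: 'd (frame e u) c h + 'd (frame e v) c h).
  exact: (is_diffD (is_diffZ a (differentiableP (dfr u))) (differentiableP (dfr v))).
have near : \forall x \near c, a *: frame e u x + frame e v x = frame e (a *: u + v) x.
  by apply: filterS (near_chart_image dom1) => x ex; rewrite frame_linear.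
exact: (diff_near h near H).
Qed.

Lemma br_linear a u v w : br (a *: u + v) w = a *: br u w + br v w.
Proof.
have aux (x1 x2 y1 y2 : tangent) :
    a *: x1 + x2 - (a *: y1 + y2) = a *: (x1 - y1) + (x2 - y2).
  by rewrite scalerBr opprD addrACA.
apply: etrans (esym (f_equal2 (fun x y => a *: x + y) (brE u w) (brE v w))).
apply: etrans (brE _ _) _.
rewrite [X in X - _](linearP ('d (frame e w) c) a u v) [X in _ - X](diff_frame_linear a u v w).
exact: aux.
Qed.

(* Left translations relate left invariant fields to themselves; the second
   order terms of the translation cancel by symmetry of its second derivative. *)
Lemma bracket_linv_br u v p : bracket (linv u) (linv v) p = linv (br u v) p.
Proof.
have pp : dom (ch p) p by exact: mem_chart_at.
set L := rep e p (L_ p).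
pose V := [set y | mul_dom p e p (coords (ch p) p, y)].
have LE : L = mulc p e p \o (fun y => (coords (ch p) p, y)).
  by apply/funext => y; rewrite /L /rep /mulc /= coordsK.
have oV : open V.
  apply: (@open_comp _ _ (fun y => (coords (ch p) p, y))); last exact: open_mul_dom.
  by move=> y _; apply: differentiable_continuous; exact: (is_diff_ex (is_diff_pairl _ _)).
have sL : smooth_on V L.
  move=> k; rewrite LE.
  exact: (Ck_comp_affine (@open_mul_dom _ _ _ p e p) (is_diff_pairl (coords (ch p) p))
           (@smooth_mulc _ _ _ p e p k)).
have Vc : V c by apply: mul_dom_coords; rewrite ?mulg1.
have nV : \forall y \near c, V y by apply: open_nbhs_nbhs; split.
have Lc : L c = coords (ch p) p by rewrite /L rep_coords// /left_translation mulg1.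
(* Left invariance in charts: L_p carries the frame at b to the frame at p b. *)
have rel w y : V y -> frame p w (L y) = 'd L y (frame e w y).
  move=> [/= _ ey]; rewrite coordsK// => py; rewrite !frameE//; last exact: (coords_image py).
  set b := point (ch e) y; rewrite {1}/L /rep /= /left_translation coordsK//.
  have eb : dom (ch e) b by exact: point_dom.
  have Lb : L_ b e = b by rewrite /left_translation mulg1.
  have Lpb : L_ (p * b)%g =1 L_ p \o L_ b.
    by move=> x; rewrite /left_translation /= mulgA.
  apply: etrans (dmap_trans w (mdiff_left b) (mdiff_left p) Lb Lpb dom1 eb py) _.
  by rewrite dmapE -/b pointK.
have dL : differentiable L c by exact: smooth_differentiable Vc.
have linvL w : linv w p = 'd L c w by rewrite linv_center -Lc rel// frame_e.
(* The derivative of [rel] at [c] along u': the chain rule on the left, [is_diff_app] on the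
   right. *)
have key u' v' : 'd (frame p v') (coords (ch p) p) (linv u' p)
    = 'D_u' (fun y => 'D_v' L y) c + 'd L c ('d (frame e v') c u').
  have dfp : differentiable (frame p v') (L c).
    by rewrite Lc; apply: differentiable_frame; exact: coords_image.
  have dfe : differentiable (frame e v') c.
    by apply: differentiable_frame; exact: coords_image.
  have nd w : \forall y \near c, 'D_w L y = 'd L y w.
    by apply: filterS nV => y Vy; rewrite deriveE//; exact: smooth_differentiable Vy.
  have dD w : differentiable (fun y => 'D_w L y) c.
    by apply: smooth_differentiable Vc; exact: smooth_derive.
  have Llin : \forall y \near c, linear (fun w => 'd L y w).
    by apply: filterS nV => y _ a w1 w2; exact: linearP.
  have H := @is_diff_app R _ _ n (fun y w => 'd L y w) _ (frame e v') _ c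
    Llin (fun w => is_diff_near (nd w) (differentiableP (dD w)))
    (differentiableP dfe).
  have near : \forall y \near c, 'd L y (frame e v' y) = (frame p v' \o L) y.
    by apply: filterS nV => y Vy /=; rewrite rel.
  have k1 : 'd (frame p v' \o L) c u' = 'd (frame p v') (L c) ('d L c u').
    exact: (congr1 (@^~ u') (diff_comp dL dfp)).
  rewrite linvL -Lc; apply: etrans (esym k1) _.
  apply: etrans (diff_near u' near H) _; congr (_ + _); rewrite frame_e.
  exact: (esym (deriveE _ (dD v'))).
have aux (x x' y y' : tangent) : x = x' -> x + y - (x' + y') = y - y'.
  by move=> ->; rewrite opprD addrACA subrr add0r.
apply: etrans (bracket_linv u v p) _.
apply: etrans (f_equal2 (fun x y => x - y) (key u v) (key v u)) _.
apply: etrans (aux _ _ _ _ (schwarz v u oV sL Vc)) _.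
apply: etrans (esym (linearB ('d L c) _ _)) _.
exact: etrans (esym (congr1 ('d L c) (brE u v))) (esym (linvL _)).
Qed.

End LeftInvariantFields.

(** * The adjoint representation *)

Section Adjoint.
Context {R : realType} {n : nat} {N : lieGroup R n}.
Local Notation tangent := 'rV[R]_n.
Local Notation "'ch' p" := (chart_at (smooth_str N) p) (at level 9, p at level 9).
Local Notation e := (1%g : N).
Local Notation c := (coords (ch e) e).
Local Notation "'L_' a" := (@left_translation R n N a) (at level 9, a at level 9).
Local Notation "'R_' a" := (@right_translation R n N a) (at level 9, a at level 9).

Let dom1 : dom (ch e) e. Proof. exact: mem_chart_at. Qed.
Hint Resolve dom1 : core.

Definition conjt (a b : N) : N := (a * b * a^-1)%g.

Lemma conjt_e a : conjt a e = e. Proof. by rewrite /conjt mulg1 mulgV. Qed.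

Lemma mdiff_conjt a : mdiff (conjt a).
Proof. exact: (mdiff_comp (mdiff_left a) (mdiff_right a^-1%g)). Qed.

Definition Ad : N -> tangent -> tangent := locked (fun a => dmap (conjt a) e e e).

Lemma AdE a : Ad a = dmap (conjt a) e e e. Proof. by rewrite /Ad -lock. Qed.

Lemma Ad_linear a : linear (Ad a).
Proof. by move=> k u v; rewrite AdE dmap_linear. Qed.

Lemma Ad_mul a b v : Ad (a * b)%g v = Ad a (Ad b v).
Proof.
rewrite !AdE; apply: dmap_trans (mdiff_conjt b) (mdiff_conjt a) (conjt_e b) _ dom1 dom1 _.
  by move=> x; rewrite /conjt /= invgM !mulgA.
by rewrite conjt_e.
Qed.

Lemma Ad_e v : Ad e v = v.
Proof.
rewrite AdE (_ : conjt e = idfun) ?dmap_id//.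
by apply/funext => x; rewrite /conjt mul1g invg1 mulg1.
Qed.

Lemma AdK a v : Ad a (Ad a^-1%g v) = v.
Proof. by rewrite -Ad_mul mulgV Ad_e. Qed.

Lemma dmap_right a x w : chart_image (ch e) x -> dom (ch e) a ->
    dom (ch e) (point (ch e) x * a)%g ->
  dmap (R_ a) e (point (ch e) x) e w = 'D_(w, 0) (mulc e e e) (x, coords (ch e) a).
Proof.
move=> ex ea exa; rewrite dmapE pointK//.
have dm : differentiable (mulc e e e) (x, coords (ch e) a).
  apply: (smooth_differentiable (@smooth_mulc _ _ N e e e)).
  by split => //=; [exact: coords_image|rewrite coordsK].
have dp := is_diff_pairr x (coords (ch e) a).
have -> : rep e e (R_ a) = mulc e e e \o (fun y => (y, coords (ch e) a)).
  by apply/funext => y; rewrite /rep /mulc /= coordsK.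
have H := is_diff_comp dp (differentiableP dm).
by rewrite (is_diff_val H) /= deriveE.
Qed.

Definition invc : tangent -> tangent := locked (rep e e (fun a => a^-1)%g).

Lemma invcE : invc = rep e e (fun a => a^-1)%g. Proof. by rewrite /invc -lock. Qed.

Lemma invc_c : invc c = c.
Proof. by rewrite invcE rep_coords// invg1. Qed.

Lemma differentiable_invc : differentiable invc c.
Proof. by rewrite invcE; apply: mdiff_inv.2; rewrite // invg1. Qed.

Lemma near_inv : \forall x \near c, dom (ch e) (point (ch e) x)^-1%g.
Proof.
apply: (near_point (P := fun a => dom (ch e) a^-1%g)) => //.
by apply: (@continuous_inv _ _ N e); rewrite invg1; exact: near_dom.
Qed.

(** Conjugation by a is L_a followed by R_(a^-1). This form shows that Ad depends differentiably on
    the point, through [frame], [invc] and the multiplication. *)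
Lemma Ad_point x v : chart_image (ch e) x -> dom (ch e) (point (ch e) x)^-1%g ->
  Ad (point (ch e) x) v = 'D_(frame e v x, 0) (mulc e e e) (x, invc x).
Proof.
move=> ex exV; set a := point (ch e) x.
have -> : invc x = coords (ch e) a^-1%g by rewrite invcE /rep.
rewrite -dmap_right// ?mulgV// -/a frameE// -/a AdE.
have La : L_ a e = a by rewrite /left_translation mulg1.
apply: dmap_trans (mdiff_left a) (mdiff_right a^-1%g) La _ dom1 _ _ => //.
- exact: point_dom.
- by rewrite /right_translation mulgV.
Qed.

Lemma diff_mul_derive w : differentiable ('D_w (mulc e e e)) (c, c).
Proof.
apply: smooth_differentiable (mul_dom_coords dom1 dom1 _); last by rewrite mulg1.
exact/smooth_derive/smooth_mulc.
Qed.

Lemma mul_derive_linear z : mul_dom e e e z -> linear (fun w => 'D_(w, 0) (mulc e e e) z).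
Proof.
move=> mz; have dm := smooth_differentiable (@smooth_mulc _ _ N e e e) mz.
move=> a u v; rewrite !deriveE//.
rewrite -linearP; congr ('d _ _ _).
by rewrite /GRing.add /= /add_pair /= scaler0 addr0.
Qed.

Definition Adc : tangent -> tangent -> tangent := locked (fun v x => Ad (point (ch e) x) v).

Lemma AdcE v x : Adc v x = Ad (point (ch e) x) v. Proof. by rewrite /Adc -lock. Qed.

Lemma Adc_c v : Adc v c = v. Proof. by rewrite AdcE coordsK// Ad_e. Qed.

Lemma differentiable_Adc v : differentiable (Adc v) c.
Proof.
have dfr : differentiable (frame e v) c.
  by apply: differentiable_frame; exact: coords_image.
pose A x w := 'D_(w, 0) (mulc e e e) (x, invc x).
have nA : \forall x \near c, linear (A x).
  apply: filterS2 (near_chart_image dom1) near_inv => x ex exV.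
  apply: mul_derive_linear; rewrite invcE.
  split=> //=; rewrite /rep /=; first exact: coords_image.
  by rewrite coordsK// mulgV.
have dA w : differentiable (A^~ w) c.
  apply: (@differentiable_comp _ _ _ _ (fun x => (x, invc x)) ('D_(w, 0) (mulc e e e))).
    by apply: differentiable_pair; [exact: ex_diff|exact: differentiable_invc].
  by rewrite invc_c; exact: diff_mul_derive.
have H := is_diff_app nA (fun w => differentiableP (dA w)) (differentiableP dfr).
apply: near_eq_differentiable (is_diff_ex H).
apply: filterS2 (near_chart_image dom1) near_inv => x ex exV.
by rewrite /A AdcE Ad_point.
Qed.

(** The differential of Ad at the identity is ad. Rather than differentiating the inverse,
    differentiate dR_a (Ad(a) v) = dL_a v: besides the derivative of Ad, the left side contributes a
    mixed derivative of the multiplication, which Schwarz identifies with the second term of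
    [brE]. *)
Lemma is_diff_Adc v : is_diff c (Adc v) (fun u => br (N:=N) u v).
Proof.
have mcc : mul_dom e e e (c, c) by apply: mul_dom_coords; rewrite // mulg1.
have sch u : 'D_(0, u) ('D_(v, 0) (mulc e e e)) (c, c) =
    'D_(v, 0) ('D_(0, u) (mulc e e e)) (c, c).
  exact: schwarz (@open_mul_dom _ _ N e e e) (@smooth_mulc _ _ N e e e) mcc.
have dfr w : differentiable (frame (N:=N) e w) c.
  by apply: differentiable_frame; exact: coords_image.
pose A x w := 'D_(w, 0) (mulc e e e) (c, x).
have nA : \forall x \near c, linear (A x).
  apply: filterS (near_chart_image dom1) => x ex.
  apply: mul_derive_linear; split=> //=; first exact: coords_image.
  by rewrite coordsK// mul1g; exact: point_dom.
have DA w : is_diff c (A^~ w) (fun u => 'D_(0, u) ('D_(w, 0) (mulc e e e)) (c, c)).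
  have H := is_diff_comp (is_diff_pairl c c) (differentiableP (diff_mul_derive (w, 0))).
  apply: is_diff_eq H _.
  by apply/funext => u /=; rewrite -deriveE//; exact: diff_mul_derive.
have Ac w : A c w = w.
  rewrite /A; have := @dmap_right e c w (coords_image dom1) dom1.
  rewrite coordsK// mulg1 => /(_ dom1) <-.
  rewrite (_ : R_ e = idfun) ?dmap_id//.
  by apply/funext => x; rewrite /right_translation mulg1.
have H := is_diff_app nA DA (differentiableP (differentiable_Adc v)).
(* This is R_a o conj_a = L_a at the level of differentials. *)
have nE : \forall x \near c, A x (Adc v x) = frame e v x.
  apply: filterS (near_chart_image dom1) => x ex; set a := point (ch e) x.
  have ea : dom (ch e) a by exact: point_dom.
  have := @dmap_right a c (Adc v x) (coords_image dom1) ea.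
  rewrite coordsK// mul1g => /(_ ea); rewrite /a pointK// /A => <-; rewrite -/a.
  rewrite AdcE frameE// -/a AdE; apply: esym.
  apply: dmap_trans (mdiff_conjt a) (mdiff_right a) (conjt_e a) _ dom1 dom1 _.
    by move=> x'; rewrite /left_translation /right_translation /conjt /= -mulgA mulVg mulg1.
  by rewrite /right_translation mul1g.
have E u := is_diff_unique u (is_diff_near nE H) (differentiableP (dfr v)).
have F u : 'd (frame (N:=N) e u) c v = 'D_(0, u) ('D_(v, 0) (mulc e e e)) (c, c).
  have H2 := is_diff_comp (is_diff_pairr c c) (differentiableP (diff_mul_derive (0, u))).
  rewrite sch deriveE; last exact: diff_mul_derive.
  have -> : 'd ('D_(0, u) (mulc e e e)) (c, c) (v, 0) =
    ('d ('D_(0, u) (mulc e e e)) (c, c) \o (fun h => (h, 0))) v by [].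
  by apply: is_diff_unique (differentiableP (dfr u)) _; rewrite frame_def.
apply: is_diff_eq (differentiableP (differentiable_Adc v)) _.
apply/funext => u; apply: esym; apply: etrans (brE u v) _.
have Eu := E u; rewrite Ac Adc_c in Eu.
have aux (x y : tangent) : x + y - x = y by rewrite addrC addKr.
apply: etrans (f_equal2 (fun x y => x - y) (esym Eu) (F u)) _.
exact: aux.
Qed.

End Adjoint.

(** * Central commutators, and endomorphisms commuting with Ad *)

Section TwoStep.
Context {R : realType} {n : nat} {N : lieGroup R n}.
Local Notation tangent := 'rV[R]_n.
Local Notation "'ch' p" := (chart_at (smooth_str N) p) (at level 9, p at level 9).
Local Notation e := (1%g : N).
Local Notation c := (coords (ch e) e).
Local Notation "'L_' a" := (@left_translation R n N a) (at level 9, a at level 9).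
Local Notation "'R_' a" := (@right_translation R n N a) (at level 9, a at level 9).
Local Notation br := (@br R n N).
Local Notation Ad := (@Ad R n N).
Local Notation Adc := (@Adc R n N).
Local Notation invc := (@invc R n N).

Let dom1 : dom (ch e) e. Proof. exact: mem_chart_at. Qed.
Hint Resolve dom1 : core.

(** A differential is linear and continuous, hence its own differential everywhere. Applied to
    [Ad a] and [br^~ w], which both arise as differentials, it provides their continuity. *)
Lemma is_diff_diff (V W : normedModType R) (f df : V -> W) (x y : V) :
  is_diff x f df -> is_diff y df df.
Proof.
move=> [fx <-]; have fc := diff_continuous fx.
by apply: DiffDef; [exact: linear_differentiable|exact: diff_lin].
Qed.

Lemma is_diff_Ad a x : is_diff x (Ad a) (Ad a).
Proof.
have : is_diff c (rep e e (conjt a)) (Ad a).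
  rewrite AdE dmapE; apply: differentiableP; apply: (mdiff_conjt a).2 => //.
  by rewrite conjt_e.
exact: is_diff_diff.
Qed.

Lemma is_diff_brl w x : is_diff x (br^~ w) (br^~ w).
Proof. exact: is_diff_diff (@is_diff_Adc R n N w). Qed.

Section Nilpotent.
Hypothesis nilN : forall a b d : N, commute [~ a, b]%g d.

(** The element b a b^-1 is [a] times a commutator, and conjugation by a central element is
    trivial. *)
Lemma Ad_conjt a b w : Ad (conjt b a) w = Ad a w.
Proof.
have E : conjt b a = (a * [~ a, b^-1])%g.
  by rewrite /conjt commgEl mulgA mulgV mul1g conjgE invgK mulgA.
rewrite !AdE; congr (dmap _ _ _ _ _); apply/funext => x.
rewrite E; have := nilN a b^-1%g x; move: [~ a, b^-1]%g => z zx.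
by rewrite /conjt invgM -(mulgA a z x) zx !mulgA -(mulgA _ z) mulgV mulg1.
Qed.

Lemma br_Ad b u w : br (Ad b u) w = br u w.
Proof.
have kc : rep e e (conjt b) c = c by rewrite rep_coords// conjt_e.
have dk : is_diff c (rep e e (conjt b)) (Ad b).
  rewrite AdE dmapE; apply: differentiableP; apply: (mdiff_conjt b).2 => //.
  by rewrite conjt_e.
have near : \forall x \near c, (Adc w \o rep e e (conjt b)) x = Adc w x.
  have cb := (mdiff_conjt b).1 e; rewrite /continuous_at conjt_e in cb.
  apply: filterS (near_point dom1 (cb _ (near_dom dom1))) => x exb.
  by rewrite /= !AdcE /rep /= coordsK// Ad_conjt.
have dAk : is_diff (rep e e (conjt b) c) (Adc w) (br^~ w).
  by rewrite kc; exact: is_diff_Adc.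
exact: (is_diff_unique u (is_diff_near near (is_diff_comp dk dAk)) (is_diff_Adc w)).
Qed.

Lemma br_nil u v w : br (br u v) w = 0.
Proof.
have H := is_diff_comp (@is_diff_Adc R n N v) (is_diff_brl w _).
have near : \forall x \near c, (br^~ w \o Adc v) x = cst (br v w) x.
  by apply: filterS (near_chart_image dom1) => x _; rewrite /= AdcE br_Ad.
exact: (is_diff_unique u (is_diff_near near H) (is_diff_cst _ _)).
Qed.
End Nilpotent.

Section Commuting.
Variable J : {linear tangent -> tangent}.
Hypothesis J_br : forall u v, J (br u v) = br u (J v).

Let F (a : N) (w : tangent) : tangent := Ad a (J (Ad a^-1%g w)).

Let F_mul a b w : F (a * b)%g w = Ad a (F b (Ad a^-1%g w)).
Proof. by rewrite /F invgM !Ad_mul. Qed.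

Let is_diff_J x : is_diff x J J.
Proof.
have Jc : continuous J.
  move=> y; apply: differentiable_continuous.
  have H : is_diff y (fun y => \sum_j y 0 j *: J (delta_mx 0 j))
      (fun h => \sum_j h 0 j *: J (delta_mx 0 j)).
    apply: is_diff_sum => j.
    have k : is_diff y (fun y : tangent => y 0 j) (fun h => h 0 j).
      exact: is_diff_coord (is_diff_id y).
    have := differentiableZf (is_diff_ex k) (differentiable_cst (J (delta_mx 0 j)) y).
    move=> H; apply: is_diff_eq.
    by apply/funext => h; rewrite (is_diff_val k) diff_cst /cst /= scaler0 addr0.
  apply: near_eq_differentiable (is_diff_ex H).
  apply: filterE => z; apply: esym; apply: linear_sum_delta => a u v; exact: linearP.
by apply: DiffDef; [exact: linear_differentiable|exact: diff_lin].
Qed.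

(** With Ad(a^-1) w having derivative - [u, w], the product rule yields [u, J w] - J [u, w] = 0. *)
Lemma is_diff_conj_e w : is_diff c (fun x => F (point (ch e) x) w) (cst 0).
Proof.
pose B x := Adc w (invc x).
pose dB u := br ('d invc c u) w.
have Bc : B c = w by rewrite /B invc_c Adc_c.
have BD : is_diff c B dB.
  have H : is_diff (invc c) (Adc w) (br^~ w) by rewrite invc_c; exact: is_diff_Adc.
  exact: (is_diff_comp (differentiableP (@differentiable_invc R n N)) H).
have nB : \forall x \near c, B x = Ad (point (ch e) x)^-1%g w.
  apply: filterS (@near_inv R n N) => x exV.
  by rewrite /B AdcE invcE /rep /= coordsK.
have lin : \forall x \near c, linear (fun v => Adc v x).
  by apply: filterS (near_chart_image dom1) => x _ k u v; rewrite !AdcE Ad_linear.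
(* The derivative of the inverse is not computed: it is read off the constancy of Ad(a) (Ad(a^-1)
   w). *)
have dBE u : dB u = - br u w.
  have H := is_diff_app lin (@is_diff_Adc R n N) BD.
  have near : \forall x \near c, Adc (B x) x = cst w x.
    by apply: filterS nB => x ->; rewrite AdcE AdK.
  have /= := is_diff_unique u (is_diff_near near H) (is_diff_cst _ _).
  by rewrite Bc Adc_c => /eqP; rewrite addrC addr_eq0 => /eqP.
have H := is_diff_app lin (@is_diff_Adc R n N) (is_diff_comp BD (is_diff_J _)).
have near : \forall x \near c, Adc (J (B x)) x = F (point (ch e) x) w.
  by apply: filterS nB => x ->; rewrite AdcE.
apply: is_diff_eq (is_diff_near near H) _; apply/funext => u /=.
by rewrite Bc Adc_c dBE linearN /= J_br subrr.
Qed.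

(** [F_mul] writes [F] near b as [F] near the identity, conjugated by the fixed map [Ad b]. *)
Lemma is_diff_conj x0 w : chart_image (ch e) x0 ->
  is_diff x0 (fun x => F (point (ch e) x) w) (cst 0).
Proof.
move=> ex0; set b := point (ch e) x0.
have eb : dom (ch e) b by exact: point_dom.
have x0E : x0 = coords (ch e) b by rewrite pointK.
have Lb : L_ b^-1%g b = e by rewrite /left_translation mulVg.
have dk : is_diff x0 (rep e e (L_ b^-1%g)) ('d (rep e e (L_ b^-1%g)) x0).
  by apply: differentiableP; rewrite x0E; apply: (mdiff_left b^-1%g).2; rewrite // Lb.
have kc : rep e e (L_ b^-1%g) x0 = c by rewrite x0E rep_coords// Lb.
have G : is_diff (rep e e (L_ b^-1%g) x0) (fun x => F (point (ch e) x) (Ad b^-1%g w)) (cst 0).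
  by rewrite kc; exact: is_diff_conj_e.
have H := is_diff_comp (is_diff_comp dk G) (is_diff_Ad b _).
have near : \forall x \near x0, (Ad b \o ((fun x => F (point (ch e) x) (Ad b^-1%g w))
    \o rep e e (L_ b^-1%g))) x = F (point (ch e) x) w.
  have cb := (mdiff_left (N := N) b^-1%g).1 b; rewrite /continuous_at Lb in cb.
  rewrite x0E; apply: filterS (near_point eb (cb _ (near_dom dom1))) => x exb.
  by rewrite /= /rep /= coordsK// -F_mul /left_translation mulgA mulgV mul1g.
apply: is_diff_eq (is_diff_near near H) _; apply/funext => u /=.
have := Ad_linear (N := N) b 0 0 0; rewrite /cst /= !scale0r !addr0 => E.
have := Ad_linear (N := N) b (-1) 0 0.
by rewrite scaler0 addr0 scaleN1r addNr.
Qed.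

Let near_conj : \forall b \near e, forall w, F b w = J w.
Proof.
have /nbhs_ballP[r /= r0 rB] := near_chart_image dom1.
have nB : \forall b \near e, ball c r (coords (ch e) b).
  have cc := continuous_coords dom1; rewrite /prop_for /continuous_at in cc.
  exact: (cc _ (nbhsx_ballx c r r0)).
apply: filterS2 nB (near_dom dom1) => b bB eb w.
have -> : J w = F (point (ch e) c) w by rewrite coordsK// /F invg1 !Ad_e.
rewrite -[in LHS](coordsK eb).
apply: (@zero_diff_ball _ _ _ (fun x => F (point (ch e) x) w) c r) => // y /rB.
exact: is_diff_conj.
Qed.

Lemma Ad_commute a v : connected [set: N] -> J (Ad a v) = Ad a (J v).
Proof.
(* [F] is locally constant around every point by [F_mul] and [near_conj], so [S] is open and
   closed. *)
move=> cN; pose S := [set a | forall w, F a w = J w].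
have locF b : \forall d \near b, forall w, F d w = F b w.
  have cb := (mdiff_left (N := N) b^-1%g).1 b.
  have Lb : L_ b^-1%g b = e by rewrite /left_translation mulVg.
  rewrite /continuous_at Lb in cb.
  have nb : \forall d \near b, forall w, F (b^-1 * d)%g w = J w by exact: (cb _ near_conj).
  apply: filterS nb => d Fd w.
  by rewrite -[d](mul1g d) -(mulgV b) -mulgA F_mul Fd.
have oS : open S.
  rewrite openE => b Sb; apply: filterS (locF b) => d Fd w.
  by rewrite Fd Sb.
have cS : closed S.
  rewrite -openC openE => b Sb; apply: filterS (locF b) => d Fd Sd.
  by apply: Sb => w; rewrite -Fd.
have ST : S = setT.
  apply: cN.
  - by exists e => w; rewrite /F invg1 !Ad_e.
  - by exists S => //; rewrite setTI.
  - by exists S => //; rewrite setTI.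
have : S a by rewrite ST.
by move=> /(_ (Ad a v)) <-; rewrite /F -Ad_mul mulVg Ad_e.
Qed.
End Commuting.

Lemma tensor_linv (S : tensor11 N) : left_invariant_tensor11 S ->
  forall p v, S p (linv v p) = linv (S e v) p.
Proof.
move=> Sl p v; have := Sl p e v.
by rewrite /linv -!lock mulg1.
Qed.

Lemma tensor_left_invariant (S : tensor11 N) (S1 : tangent -> tangent) :
  (forall p v, S p (linv v p) = linv (S1 v) p) -> left_invariant_tensor11 S.
Proof.
move=> Sl a p w; have [v <-] := linv_surj p w.
by rewrite Sl !tangent_mapE -!linv_mul Sl.
Qed.

Lemma tensor_right_invariant (S : tensor11 N) (S1 : tangent -> tangent) :
  (forall p v, S p (linv v p) = linv (S1 v) p) ->
  (forall a v, S1 (Ad a v) = Ad a (S1 v)) -> right_invariant_tensor11 S.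
Proof.
move=> Sl SAd a p w; have [v <-] := linv_surj p w.
(* Right translation twists left invariant fields by Ad(a^-1), since R_a o L_p = L_(p a) o
   conj_(a^-1). *)
have RL u : tangent_map (R_ a) p (linv u p) = linv (Ad a^-1%g u) (p * a)%g.
  have pp : dom (ch p) p by exact: mem_chart_at.
  have paa : dom (ch (p * a)%g) (p * a)%g by exact: mem_chart_at.
  have Lp q : L_ q e = q by rewrite /left_translation mulg1.
  rewrite tangent_mapE !linvE AdE -[R_ a p]/(p * a)%g.
  rewrite -(@dmap_trans _ _ _ (L_ p) (R_ a) (R_ a \o L_ p) e e p p (p * a)%g)//; first last.
  - exact: mdiff_right.
  - exact: mdiff_left.
  apply: dmap_trans (mdiff_conjt _) (mdiff_left _) (conjt_e _) _ dom1 dom1 _; last by rewrite Lp.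
  move=> x; rewrite /= /left_translation /right_translation /conjt invgK.
  by rewrite !mulgA -(mulgA p a) mulgV mulg1.
by rewrite RL !Sl RL SAd.
Qed.

End TwoStep.

(** * Killing-Yano tensors and the complex structure *)

Section SmoothFields.
Context {R : realType} {n : nat} {N : lieGroup R n}.
Local Notation tangent := 'rV[R]_n.

Lemma smooth_field_comb a (X Y : N -> tangent) : smooth_field X -> smooth_field Y ->
  smooth_field (fun p => a *: X p + Y p).
Proof.
move=> sX sY q k.
have oU := @open_image_coords _ _ _ (chart_at (smooth_str N) q).
have -> : local_field q (fun p => a *: X p + Y p) =
    fun x => a *: local_field q X x + local_field q Y x.
  by apply/funext => x; rewrite !local_fieldE dmap_linear.
by apply: CkD => //; [apply: CkZ => //; exact: sX|exact: sY].
Qed.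
End SmoothFields.

(** * Polynomials in a tensor field *)

Section MatrixTensor.
Context {R : realType} {n : nat} {N : lieGroup R n.+1}.
Local Notation tangent := 'rV[R]_n.+1.
Local Notation e := (1%g : N).
Variables (T : tensor11 N) (r : {poly R}).

Definition poly_tensor : tensor11 N := fun p => mulmxr (horner_mx (lin1_mx (T p)) r).

Lemma poly_tensorE p v : poly_tensor p v = v *m horner_mx (lin1_mx (T p)) r.
Proof. by []. Qed.

Lemma smooth_poly_tensor : smooth_tensor11 T -> smooth_tensor11 poly_tensor.
Proof.
move=> sT X sX; rewrite /app_field /poly_tensor /=.
elim/poly_ind: r => [|q a IH].
  rewrite (_ : (fun _ => _) = fun p => -1 *: X p + X p); first exact: smooth_field_comb.
  by apply/funext => p; rewrite rmorph0 mulmx0 scaleN1r addNr.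
rewrite (_ : (fun _ => _) = fun p => a *: X p +
    app_field T (fun p => X p *m horner_mx (lin1_mx (T p)) q) p).
  by apply: smooth_field_comb => //; exact: sT.
apply/funext => p; rewrite rmorphD rmorphM /= horner_mx_X horner_mx_C mulmxDr addrC.
by rewrite mul_mx_scalar -mulmxE mulmxA /app_field mul_rV_lin1.
Qed.

Lemma poly_tensor_linv : left_invariant_tensor11 T -> forall p v,
  poly_tensor p (linv v p) = linv (v *m horner_mx (lin1_mx (T e)) r) p.
Proof.
move=> Tl p v; rewrite poly_tensorE.
have lD a u w := linv_linear (N := N) p a u w.
elim/poly_ind: r => [|q a IH]; first by rewrite !rmorph0 !mulmx0 linv0.
rewrite !rmorphD !rmorphM /= !horner_mx_X !horner_mx_C !mulmxDr -!mulmxE !mulmxA IH.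
by rewrite !mul_mx_scalar !mul_rV_lin1 /= tensor_linv// addrC -lD addrC.
Qed.
End MatrixTensor.

(** * The Koszul formula for left invariant fields *)

Section KillingYano.
Context {R : realType} {n : nat} {N : lieGroup R n}.
Local Notation tangent := 'rV[R]_n.
Local Notation e := (1%g : N).
Local Notation br := (@br R n N).
Variables (g : N -> tangent -> tangent -> R)
  (nabla : (N -> tangent) -> (N -> tangent) -> (N -> tangent)) (T : tensor11 N).
Hypothesis gR : riemannian_metric g.
Hypothesis gL : left_invariant_metric g.

Lemma metric_linv p u v : g p (linv u p) (linv v p) = g e u v.
Proof.
have := gL p e (linv u e) (linv v e).
by rewrite !tangent_mapE -!linv_mul mulg1 !linv_e.
Qed.

Lemma metric_sym p u v : g p u v = g p v u. Proof. by case: gR. Qed.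
Lemma metric_lin p a u v w : g p (a *: u + v) w = a * g p u w + g p v w.
Proof. by case: gR. Qed.

Hypothesis LC : levi_civita g nabla.

(** Inner products of left invariant fields are constant, so metric compatibility says that each
    nabla_u is skew. Three such relations and the vanishing torsion determine the connection. *)
Lemma koszul x y w : 2 * g e (nabla (linv x) (linv y) e) w =
  g e (br x y) w - g e (br y w) x + g e (br w x) y.
Proof.
case: LC => _ tor met; have sl := @smooth_linv R n N.
have tors u v z : g e (br u v) z = g e (nabla (linv u) (linv v) e) z
    - g e (nabla (linv v) (linv u) e) z.
  rewrite [br u v](_ : _ = -1 *: nabla (linv v) (linv u) e + nabla (linv u) (linv v) e).
    by rewrite metric_lin mulN1r addrC.
  by rewrite br_def -tor// scaleN1r addrC.
have metr u v z : g e (nabla (linv u) (linv v) e) z = - g e (nabla (linv u) (linv z) e) v.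
  have := met _ _ _ e (sl u) (sl v) (sl z).
  rewrite !linv_e (metric_sym e v) /lie_derivative.
  rewrite (_ : _ \o _ = cst (g e v z)); last first.
    by apply/funext => q; rewrite /= metric_linv.
  by rewrite derive_cst => /esym/eqP; rewrite addr_eq0 => /eqP.
by have := metr x y w; have := metr y w x; have := metr w x y; rewrite !tors; lra.
Qed.

Hypothesis KY : killing_yano g nabla T.
Hypothesis TL : left_invariant_tensor11 T.

Lemma killing_yano_br x y w :
  g e (br x (T e y)) w + g e (br w (T e y)) x + g e (br w x) (T e y)
  + g e (br y (T e x)) w + g e (br w (T e x)) y + g e (br w y) (T e x)
  = - (2 * (g e (br (T e w) x) y + g e (br (T e w) y) x)).
Proof.
case: KY => sT Tskew /(_ _ _ e (smooth_linv (N := N) x) (smooth_linv (N := N) y)).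
have appT u : app_field T (linv u) = linv (T e u).
  by apply/funext => p; rewrite /app_field tensor_linv.
rewrite /covariant_derivative11 !appT => E.
have gN p u v : g p (- u) v = - g p u v.
  have g0 : g p 0 v = 0 by have := metric_lin p (-1) 0 0 v; rewrite scaler0 addr0; lra.
  by have := metric_lin p (-1) u 0 v; rewrite addr0 scaleN1r g0 addr0 mulN1r.
have gB p u u' v : g p (u - u') v = g p u v - g p u' v.
  by have := metric_lin p 1 u (- u') v; rewrite scale1r mul1r gN.
have /(congr1 (fun z => g e z w)) := E; rewrite gN !gB !Tskew.
(* Skewness of T moves it from nabla_x y onto [w], which explains the arguments [T e w]. *)
have k1 := koszul x (T e y) w; have k2 := koszul x y (T e w).
have k3 := koszul y (T e x) w; have k4 := koszul y x (T e w).
have bN u v z : g e (br u v) z = - g e (br v u) z by rewrite brN gN.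
have := bN x y (T e w); have := bN (T e y) w x; have := bN y (T e w) x.
have := bN (T e x) w y; have := bN x (T e w) y.
lra.
Qed.
End KillingYano.

(** * Integrability *)

Section Nijenhuis.
Context {R : realType} {n : nat} {N : lieGroup R n}.
Local Notation tangent := 'rV[R]_n.
Local Notation "'ch' p" := (chart_at (smooth_str N) p) (at level 9, p at level 9).
Local Notation e := (1%g : N).
Local Notation br := (@br R n N).
Variables (g : N -> tangent -> tangent -> R) (J : tensor11 N) (J1 : {linear tangent -> tangent}).
Hypothesis gR : riemannian_metric g.
Hypothesis gL : left_invariant_metric g.
Hypothesis JE : forall p v, J p (linv v p) = linv (J1 v) p.

(** Makes the coefficients of a field in the left invariant frame inner products with left invariant
    fields, whose smoothness is part of [riemannian_metric]. The [w i] come from the inverse of the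
    Gram matrix [G]. *)
Lemma dual_basis : exists w : 'I_n -> tangent, forall v i, g e v (w i) = v 0 i.
Proof.
have [gC gP g_gt0 _] := gR.
have glin w : linear (fun v => g e v w : R^o) by move=> a u v; exact: gP.
pose G := \matrix_(i, j) g e (delta_mx 0 i) (delta_mx 0 j).
have gG u v : g e u v = (u *m G *m v^T) 0 0.
  rewrite [LHS](linear_sum_delta u (glin v)) -mulmxA mxE; apply: eq_bigr => i _.
  rewrite mxE /GRing.scale /=; congr (_ * _).
  rewrite gC [LHS](linear_sum_delta v (glin _)); apply: eq_bigr => j _.
  by rewrite !mxE /GRing.scale /= mulrC gC.
have Gu : G \in unitmx.
  rewrite -row_free_unit -kermx_eq0; apply/eqP/row_matrixP => i; rewrite row0.
  apply/eqP; apply/negPn/negP => /(g_gt0 e).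
  by rewrite gG -row_mul mulmx_ker row0 mul0mx mxE ltxx.
exists (fun i => (invmx G *m (delta_mx i 0))^T) => v i.
by rewrite gG trmxK mulmxA mulmxK// -colE mxE.
Qed.

(** Write X and J X with the same coefficients in the frames of the [delta_mx 0 i] and of their
    images under [J1]. The terms that differentiate the coefficients correspond under J, and the
    rest involves X only through its value at [p]. It matters that [K] and [w] are chosen before
    X. *)
Lemma derive_local_J (p : N) h : exists K : 'I_n -> tangent, exists w : 'I_n -> tangent,
  forall X, smooth_field X ->
    'D_h (local_field p (app_field J X)) (coords (ch p) p)
    = J p ('D_h (local_field p X) (coords (ch p) p)) + \sum_i g p (X p) (w i) *: K i.
Proof.
have pp : dom (ch p) p by exact: mem_chart_at.
have [wd wdE] := dual_basis; set x0 := coords (ch p) p.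
pose d u := 'd (frame (N := N) p u) x0 h.
exists (fun i => d (J1 (delta_mx 0 i)) - J p (d (delta_mx 0 i))).
exists (fun i => linv (wd i) p) => X sX.
pose f i q := g q (X q) (linv (wd i) q).
have dec q : exists2 v, X q = linv v q & forall i, f i q = v 0 i.
  by have [v Ev] := linv_surj q (X q); exists v => // i; rewrite /f -Ev metric_linv.
have dfr u : differentiable (frame (N := N) p u) x0.
  by apply: differentiable_frame; exact: coords_image.
have df i : differentiable (f i \o point (ch p) : _ -> R) x0.
  have [_ _ _ gs] := gR.
  apply: (smooth_differentiable (gs _ _ sX (smooth_linv (wd i)) p)).
  exact: coords_image.
pose S (u : 'I_n -> tangent) x := \sum_i (f i \o point (ch p)) x *: frame p (u i) x.
have SD u : 'D_h (S u) x0 = \sum_i ('d (f i \o point (ch p) : _ -> R) x0 h *: linv (u i) p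
    + f i p *: d (u i)).
  have H := is_diff_sum (fun i => differentiableZf (df i) (dfr (u i))).
  rewrite deriveE; last exact: (is_diff_ex H).
  apply: etrans (congr1 (@^~ h) (is_diff_val H)) _ => /=.
  by apply: eq_bigr => i _; rewrite -linv_center coordsK.
have local_sum Y (u : 'I_n -> tangent) :
    (forall q, Y q = \sum_i f i q *: linv (u i) q) ->
    'D_h (local_field p Y) x0 = 'D_h (S u) x0.
  move=> YE; apply: near_eq_derive; apply: filterS (near_chart_image pp) => x px.
  rewrite local_fieldE YE /S.
  set q := point (ch p) x.
  rewrite [LHS](_ : _ = \sum_i f i q *: dmap idfun q q p (linv (u i) q)).
    by apply: eq_bigr => i _; rewrite -local_field_linv// local_fieldE.
  by rewrite dmapE linear_sum; apply: eq_bigr => i _; rewrite linearZ.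
rewrite (local_sum X (fun i => delta_mx 0 i)); last first.
  move=> q; have [v -> fv] := dec q.
  rewrite [LHS](linear_sum_delta v (linv_linear q)).
  by apply: eq_bigr => i _; rewrite fv.
rewrite (local_sum _ (fun i => J1 (delta_mx 0 i))); last first.
  move=> q; rewrite /app_field; have [v -> fv] := dec q; rewrite JE.
  have lJ : linear (fun v => linv (J1 v) q) by move=> a u w; rewrite linearP linv_linear.
  rewrite [LHS](linear_sum_delta v lJ).
  by apply: eq_bigr => i _; rewrite fv.
rewrite !SD linear_sum -big_split; apply: eq_bigr => i _ /=.
by rewrite linearD !linearZ /= JE -/(f i p) scalerBr -addrA subrKC.
Qed.

Hypothesis J1J1 : forall v, J1 (J1 v) = - v.
Hypothesis J1_br : forall u v, J1 (br u v) = br u (J1 v).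

Lemma app_field_linv v : app_field J (linv v) = linv (J1 v).
Proof. by apply/funext => p; rewrite /app_field JE. Qed.

Lemma nijenhuis_linv u v p :
  bracket (app_field J (linv u)) (app_field J (linv v)) p
  - J p (bracket (app_field J (linv u)) (linv v) p)
  - J p (bracket (linv u) (app_field J (linv v)) p)
  - bracket (linv u) (linv v) p = 0.
Proof.
have J1_brl x y : br (J1 x) y = J1 (br x y).
  by rewrite brN -J1_br brN linearN opprK.
rewrite !app_field_linv !bracket_linv_br !JE !J1_brl -!J1_br !J1J1.
by rewrite linvN opprK addNr add0r subrr.
Qed.

Definition component_derivative : N -> tangent -> (N -> tangent) -> tangent :=
  locked (fun p h X => 'D_h (local_field p X) (coords (ch p) p)).

Lemma component_derivativeE p h X :
  component_derivative p h X = 'D_h (local_field p X) (coords (ch p) p).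
Proof. by rewrite /component_derivative -lock. Qed.

Lemma bracketE X Y p : bracket X Y p =
  component_derivative p (X p) Y - component_derivative p (Y p) X.
Proof. by rewrite /component_derivative -lock. Qed.

(** Both arguments are replaced by left invariant fields with the same values at [p], where
    [nijenhuis_linv] applies. *)
Lemma nijenhuis X Y p : smooth_field X -> smooth_field Y ->
  bracket (app_field J X) (app_field J Y) p - J p (bracket (app_field J X) Y p)
  - J p (bracket X (app_field J Y) p) - bracket X Y p = 0.
Proof.
move=> sX sY; have [u Eu] := linv_surj p (X p); have [v Ev] := linv_surj p (Y p).
rewrite -[RHS](nijenhuis_linv u v p).
(* Choice makes [K] and [w] functions of the direction alone, so that the expansions for X, Y and
   for the left invariant fields share them. *)
pose K h := projT1 (cid (derive_local_J p h)).
have KP h : exists w, forall X, smooth_field X ->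
    component_derivative p h (app_field J X)
    = J p (component_derivative p h X) + \sum_i g p (X p) (w i) *: K h i.
  have [w Hw] := projT2 (cid (derive_local_J p h)); exists w => Z sZ.
  rewrite !component_derivativeE; exact: Hw.
pose w h := projT1 (cid (KP h)).
have wP h Z : smooth_field Z -> component_derivative p h (app_field J Z)
    = J p (component_derivative p h Z) + \sum_i g p (Z p) (w h i) *: K h i.
  by move: Z; exact: (projT2 (cid (KP h))).
have JJ z : J p (J p z) = - z.
  by have [v0 <-] := linv_surj p z; rewrite !JE J1J1 linvN.
(* [s1], ..., [s4] depend on the values of the two fields at [p] only, while the
   derivatives [d1], ..., [d4] cancel. *)
have aux d1 d2 d3 d4 s1 s2 s3 s4 :
    J p d1 + s1 - (J p d2 + s2) - J p (d1 - (J p d3 + s3)) - J p (J p d4 + s4 - d2) - (d4 - d3)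
    = s1 - s2 + J p s3 - J p s4.
  by rewrite !linearB !linearD !JJ; apply/rowP => j; rewrite !mxE; ring.
have key A B : smooth_field A -> smooth_field B ->
    bracket (app_field J A) (app_field J B) p - J p (bracket (app_field J A) B p)
    - J p (bracket A (app_field J B) p) - bracket A B p =
    \sum_i g p (B p) (w (J p (A p)) i) *: K (J p (A p)) i
    - \sum_i g p (A p) (w (J p (B p)) i) *: K (J p (B p)) i
    + J p (\sum_i g p (A p) (w (B p) i) *: K (B p) i)
    - J p (\sum_i g p (B p) (w (A p) i) *: K (A p) i).
  move=> sA sB; rewrite !bracketE ![app_field J _ p]/(J p _).
  by rewrite (wP _ A sA) (wP _ A sA) (wP _ B sB) (wP _ B sB); exact: aux.
apply: etrans (key X Y sX sY) _.
apply: etrans _ (esym (key (linv u) (linv v) (smooth_linv u) (smooth_linv v))).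
by rewrite Eu Ev.
Qed.
End Nijenhuis.

(** All tangent vectors are equal here, so T itself serves as J. The case is separate because
    polynomials in a matrix are taken in the ring of matrices of size [n.+1]. *)
Lemma complex_structure_dim0 (R : realType) (N : lieGroup R 0)
    (g : N -> 'rV[R]_0 -> 'rV[R]_0 -> R) (T : tensor11 N) :
  smooth_tensor11 T -> complex_lie_group_structure T /\ hermitian_metric g T.
Proof.
have eq0 (u v : 'rV[R]_0) : u = v by rewrite (thinmx0 u) (thinmx0 v).
by move=> sT; split=> [|p u v]; [split=> // *; exact: eq0|congr (g p _ _); exact: eq0].
Qed.

Lemma complex_structure_pos_dim (R : realType) (n : nat) (N : lieGroup R n.+1)
    (g : N -> 'rV[R]_n.+1 -> 'rV[R]_n.+1 -> R)
    (nabla : (N -> 'rV[R]_n.+1) -> (N -> 'rV[R]_n.+1) -> (N -> 'rV[R]_n.+1))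
    (T : tensor11 N) :
  connected [set: N] -> two_step_nilpotent N ->
  riemannian_metric g -> left_invariant_metric g -> levi_civita g nabla ->
  killing_yano g nabla T -> invertible_tensor11 T -> left_invariant_tensor11 T ->
  exists J : tensor11 N, complex_lie_group_structure J /\ hermitian_metric g J.
Proof.
move=> cN [_ nilN] gR gL LC KY Tinv TL.
have [gC gP g_gt0 _] := gR; have [sT Tskew _] := KY.
set T1 := lin1_mx (T 1%g).
have T1E u : u *m T1 = T 1%g u by rewrite mul_rV_lin1.
have T1u : T1 \in unitmx.
  rewrite -row_free_unit -kermx_eq0; apply/eqP/row_matrixP => i; rewrite row0.
  apply: (bij_inj (Tinv 1%g)); rewrite linear0 -T1E.
  by rewrite -row_mul mulmx_ker row0.
have KYbr x y w := killing_yano_br gR gL LC KY TL x y w.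
have [|||r [JJ J_br J_g]] := killing_yano_polar (br := br (N := N)) (T := T1)
    (gC 1%g) (gP 1%g) (g_gt0 1%g) (@br_linear _ _ N) (@brN _ _ N) _ _ T1u _.
- exact: br_nil.
- by move=> u v; rewrite !T1E.
- by move=> x y w; rewrite !T1E.
pose J := poly_tensor T r; pose J1 := mulmxr (horner_mx T1 r) : {linear 'rV[R]_n.+1 -> 'rV[R]_n.+1}.
have JE p v : J p (linv v p) = linv (J1 v) p by exact: poly_tensor_linv.
have J1J1 v : J1 (J1 v) = - v by rewrite /= -mulmxA JJ mulmxN mulmx1.
have J1_br u v : J1 (br (N := N) u v) = br (N := N) u (J1 v).
  have H : br (N := N) u v *m horner_mx T1 r = br (N := N) u (v *m horner_mx T1 r).
    by rewrite (brN u v) mulNmx J_br (brN (v *m _)) opprK.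
  exact: H.
exists J; split; last first.
  move=> p u v; have [u' <-] := linv_surj p u; have [v' <-] := linv_surj p v.
  by rewrite !JE !(metric_linv gL) J_g.
split.
- split.
  + exact: smooth_poly_tensor.
  + by move=> p v; have [v' <-] := linv_surj p v; rewrite !JE J1J1 linvN.
  + by move=> X Y p; exact: nijenhuis gR gL JE J1J1 J1_br X Y p.
- exact: tensor_left_invariant JE.
- apply: tensor_right_invariant JE _ => a v.
  exact: Ad_commute J1_br a v cN.
Qed.

Theorem theorem3p7 (R : realType) (n : nat) (N : lieGroup R n)
    (g : N -> 'rV[R]_n -> 'rV[R]_n -> R)
    (nabla : (N -> 'rV[R]_n) -> (N -> 'rV[R]_n) -> (N -> 'rV[R]_n))
    (T : tensor11 N) :
  connected [set: N] ->
  two_step_nilpotent N ->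
  riemannian_metric g ->
  left_invariant_metric g ->
  levi_civita g nabla ->
  killing_yano g nabla T ->
  invertible_tensor11 T ->
  left_invariant_tensor11 T ->
  exists J : tensor11 N,
    complex_lie_group_structure J /\ hermitian_metric g J.
Proof.
case: n N g nabla T => [|n] N g nabla T; last exact: complex_structure_pos_dim.
by move=> _ _ _ _ _ [sT _ _] _ _; exists T; exact: complex_structure_dim0.
Qed.
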